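(* Suppose that $a<0$, $a+b\le0$ and $\psi\in C([-1,0];\mathbb{R})$. Let $X$ be the unique continuous adapted process satisfying $$dX(t)=\Big(aX(t)+\frac{b}{1+t}\int_{-1}^t X(s)\,ds\Big)\,dt+\sigma\,dB(t),\quad t\ge 0;\qquad X(t)=\psi(t),\quad t\in[-1,0].$$ Then, for all $\Delta\ge0$: (a) If $a+b<0$, then $$\lim_{t\to\infty}\mathrm{Cov}(X(t),X(t+\Delta))=\frac{\sigma^2}{2|a|}e^{a\Delta}.$$ (b) If $a+b=0$, then $$\lim_{t\to\infty}\mathrm{Cov}(X(t),X(t+\Delta))=\frac{\sigma^2}{2|a|}e^{a\Delta}+\sigma^2\frac{b^2}{|a|^{2+\frac{2b}{a}}}\int_0^\infty(1+s)^2\,U\big(1-\tfrac ba,2,|a|(1+s)\big)^2\,ds.$$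
   Context: $a,b\in\mathbb{R}$, $\sigma>0$, $\psi$ is deterministic, and $B$ is a standard one-dimensional Brownian motion on a complete probability space with a filtration satisfying the usual conditions, to which $B$ is adapted. $U(\alpha,\beta,z)$ denotes the Tricomi confluent hypergeometric function: for real $\alpha,\beta$ and $z>0$ it is the solution of Kummer's equation $z w''(z)+(\beta-z)w'(z)-\alpha w(z)=0$ determined by $z^{\alpha}U(\alpha,\beta,z)\to1$ as $z\to\infty$. *)

(* Defs.v *)
From HB Require Import structures.
From mathcomp Require Import all_boot all_order all_algebra.
From mathcomp Require Import all_classical all_reals all_analysis.

Set Implicit Arguments.
Unset Strict Implicit.
Unset Printing Implicit Defensive.

Import Order.TTheory GRing.Theory Num.Theory.
Import numFieldNormedType.Exports.

Local Open Scope classical_set_scope.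
Local Open Scope ring_scope.

Definition is_tricomi (R : realType) (alpha beta : R) (w : R -> R) : Prop :=
  (forall z : R, 0 < z ->
     [/\ derivable w z 1,
         derivable (derive1 w) z 1 &
         z * derive1 (derive1 w) z + (beta - z) * derive1 w z - alpha * w z = 0])
  /\ (z `^ alpha * w z @[z --> +oo] --> (1 : R)).

(* [is_tricomi] determines [w] only on the positive half-line, so
   [tricomiU alpha beta z] is meaningful only for [0 < z]. *)
Definition tricomiU (R : realType) (alpha beta : R) : R -> R :=
  xget (fun=> 0) [set w | is_tricomi alpha beta w].

(* Filtrations and processes are indexed by [R]; except for the initial segment
   of the solution [X] on [-1, 0], only nonnegative times are constrained. *)
Record usual_filtration (d : measure_display) (T : measurableType d)
    (R : realType) (P : probability T R) (F : R -> set (set T)) : Prop := {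
  filtration_sigma_algebra :
    forall t : R, 0 <= t -> sigma_algebra setT (F t) ;
  filtration_measurable :
    forall t : R, 0 <= t -> F t `<=` measurable ;
  filtration_nondecreasing :
    forall s t : R, 0 <= s -> s <= t -> F s `<=` F t ;
  filtration_right_continuous :
    forall t : R, 0 <= t -> \bigcap_(s in [set s | t < s]) F s `<=` F t ;
  filtration_complete :
    P.-negligible `<=` F 0 }.

Definition adapted (T : Type) (R : realType) (F : R -> set (set T))
    (X : R -> T -> R) : Prop :=
  forall t : R, 0 <= t -> forall A : set R, measurable A -> F t (X t @^-1` A).

Record brownian_motion (d : measure_display) (T : measurableType d)
    (R : realType) (P : probability T R) (B : R -> T -> R) : Prop := {
  brownian_measurable :
    forall t : R, 0 <= t -> measurable_fun setT (B t) ;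
  brownian_start :
    {ae P, forall w, B 0 w = 0} ;
  brownian_continuous :
    {ae P, forall w, {within `[0, +oo[, continuous (fun t => B t w)}} ;
  (* the second parameter of [normal_prob] is the standard deviation; [s < t] is
     strict because [normal_prob m 0] is not a Dirac mass *)
  brownian_gaussian :
    forall s t : R, 0 <= s -> s < t -> forall A : set R, measurable A ->
      P ((B t \- B s) @^-1` A) = normal_prob 0 (Num.sqrt (t - s)) A ;
  brownian_independent :
    forall (n : nat) (t : nat -> R) (A : nat -> set R),
      0 <= t 0%N -> nondecreasing_seq t -> (forall i, measurable (A i)) ->
      P (\bigcap_(i < n) ((B (t i.+1) \- B (t i)) @^-1` A i)) =
      (\prod_(i < n) P ((B (t i.+1) \- B (t i))%R @^-1` A i))%E }.

(* Continuous adapted solution of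
     dX(t) = (a X(t) + b / (1 + t) \int_{-1}^t X(s) ds) dt + sigma dB(t)
   for t >= 0, with X = psi on [-1, 0].  The noise is additive, so its
   stochastic integral over [0, t] is sigma (B(t) - B(0)). *)
Record average_sde_solution (d : measure_display) (T : measurableType d)
    (R : realType) (P : probability T R) (F : R -> set (set T))
    (B : R -> T -> R) (a b sigma : R) (psi : R -> R)
    (X : R -> T -> R) : Prop := {
  solution_adapted : adapted F X ;
  solution_continuous :
    {ae P, forall w, {within `[-1, +oo[, continuous (fun t => X t w)}} ;
  solution_initial :
    {ae P, forall w, forall t, t \in `[-1, 0] -> X t w = psi t} ;
  solution_equation :
    {ae P, forall w, forall t : R, 0 <= t ->
       X t w = X 0 w
         + \int[lebesgue_measure]_(u in `[0, t])
             (a * X u w + b / (1 + u) *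
                \int[lebesgue_measure]_(s in `[-1, u]) X s w)
         + sigma * (B t w - B 0 w)} }.

(* Main.v *)
Require Import Defs.
From HB Require Import structures.
From mathcomp Require Import all_boot all_order all_algebra.
From mathcomp Require Import all_classical all_reals all_analysis.
From mathcomp Require Import ring lra measurable_realfun.

(** Let [I] be the running integral of [X] from time [-1].  The pair [(I, X)]
    solves a linear system with additive noise, so [X t] is a constant plus
    [sigma] times the Wiener integral of the resolvent [s |-> q_t s] over
    [[0, t]], where [q_t] is the second component of the backward system
    [adjoint_pair] started from [(0, 1)] at time [t].  By the Ito isometry
    [Cov (X t, X (t + Delta))] is [sigma^2] times the integral over [[0, t]] of
    [q_t q_{t+Delta}], and only the behaviour of [q_t] for large [t] matters.

    As [q_t] is differentiable, the Wiener integral exists path by path: along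
    almost every path the sums of [q_t (s_i) (B (s_{i+1}) - B (s_i))] over dyadic grids
    converge to the increment of [p I + q_t X] ([adjoint_path_sums]).  These
    sums are Cauchy in mean square because Brownian increments are centred and
    orthogonal ([wiener_sum_cauchy]), and Fatou's lemma identifies the two
    limits ([mean_square_limit]); this gives [solution_covariance].

    In both cases [q_t s = e^{a (t - s)} + kap s] up to an error of order
    [(1 + t)^{g-1} (1 + s)^{-g}] with [1/2 < g < 1], where [kap s] is of order
    [1 / (1 + s)].  In the product [q_t q_{t+Delta}] the exponentials integrate
    to the Ornstein-Uhlenbeck covariance [e^{a Delta} / (2 |a|)] in the limit,
    [kap ^ 2] contributes its integral, and the other terms vanish
    ([kernel_increment_bound], [covariance_limit]).

    When [a + b < 0] one has [kap = 0]: the slow mode of the backward system is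
    of order [(1 + s)^{- b / |a|}] with [b / |a| < 1], which an energy estimate
    turns into the stated error ([adjoint_decay]).

    When [a + b = 0] the function [1 + t] solves the equation satisfied by [I]
    without noise, and reduction of order gives the resolvent in closed form
    ([critical_adjoint_pair]).  Its limit as [t] grows is
    [kap s = x e^{|a| x} \int_x^oo e^{a u} / u^2 du] with [x = 1 + s], and
    [U (2, 2, z) = e^z \int_z^oo e^{-v} / v^2 dv] ([tricomiU_22]), so that
    [kap s = |a| (1 + s) U (2, 2, |a| (1 + s))].  Here [1 - b / a = 2] and
    [2 + 2 b / a = 0], which is the form of the constant in the theorem. *)

Set Implicit Arguments.
Unset Strict Implicit.
Unset Printing Implicit Defensive.

Import Order.TTheory GRing.Theory Num.Theory.
Import numFieldNormedType.Exports.

Local Open Scope classical_set_scope.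
Local Open Scope ring_scope.

(** * Derivatives and mean value inequalities *)

Section pointwise_derivatives.
Context {R : realType}.
Implicit Types (f g : R -> R) (x c : R).

Lemma is_derive_funD f g x df dg : is_derive x 1 f df -> is_derive x 1 g dg ->
  is_derive x 1 (fun y => f y + g y) (df + dg).
Proof. by move=> ? ?; apply: is_deriveD. Qed.

Lemma is_derive_funB f g x df dg : is_derive x 1 f df -> is_derive x 1 g dg ->
  is_derive x 1 (fun y => f y - g y) (df - dg).
Proof. by move=> ? ?; apply: is_deriveB. Qed.

Lemma is_derive_funN f x df : is_derive x 1 f df ->
  is_derive x 1 (fun y => - f y) (- df).
Proof. by move=> ?; apply: is_deriveN. Qed.

Lemma is_derive_funM f g x df dg : is_derive x 1 f df -> is_derive x 1 g dg ->
  is_derive x 1 (fun y => f y * g y) (f x * dg + g x * df).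
Proof. by move=> ? ?; apply: is_deriveM. Qed.

Lemma is_derive_funX f n x df : is_derive x 1 f df ->
  is_derive x 1 (fun y => f y ^+ n) (n%:R * f x ^+ n.-1 * df).
Proof.
move=> fd; rewrite (_ : (fun y => _) = f ^+ n); first exact: is_deriveX.
by rewrite exprfctE.
Qed.

Lemma is_derive_funV f x df : f x != 0 -> is_derive x 1 f df ->
  is_derive x 1 (fun y => (f y)^-1) (- (f x ^- 2 * df)).
Proof.
move=> fx0 fd; rewrite -mulNr; exact: is_deriveV.
Qed.

Lemma is_derive_funexp f x df : is_derive x 1 f df ->
  is_derive x 1 (fun y => expR (f y)) (expR (f x) * df).
Proof. by move=> ?; apply: is_derive1_comp. Qed.

Lemma is_derive_funpow f r x df : 0 < f x -> is_derive x 1 f df ->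
  is_derive x 1 (fun y => f y `^ r) (r * f x `^ (r - 1) * df).
Proof.
move=> fx0 fd.
exact: (@is_derive1_comp _ (fun z => z `^ r) f x _ _ (is_derive1_powR r fx0) fd).
Qed.

Lemma is_derive_funcst c x : is_derive x 1 (fun=> c) 0.
Proof. exact: is_derive_cst. Qed.

Lemma is_derive_funid x : is_derive x 1 (fun y => y) 1.
Proof. exact: is_derive_id. Qed.

End pointwise_derivatives.

(** Dispatch on the head symbol: unification of a whole function against each
    rule in turn would unfold [expR] and [powR]. *)
Ltac derive_rules :=
  lazymatch goal with
  | |- is_derive _ _ (fun _ => ?c) _ => eapply is_derive_funcst
  | |- is_derive _ _ (fun y => @?f y + @?g y) _ =>
      eapply (@is_derive_funD _ f g); derive_rules
  | |- is_derive _ _ (fun y => - @?f y) _ =>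
      eapply (@is_derive_funN _ f); derive_rules
  | |- is_derive _ _ (fun y => @?f y ^+ ?n) _ =>
      eapply (@is_derive_funX _ f n); derive_rules
  | |- is_derive _ _ (fun y => @?f y * @?g y) _ =>
      eapply (@is_derive_funM _ f g); derive_rules
  | |- is_derive _ _ (fun y => (@?f y)^-1) _ =>
      eapply (@is_derive_funV _ f); [cbv beta; try eassumption|derive_rules]
  | |- is_derive _ _ (fun y => expR (@?f y)) _ =>
      eapply (@is_derive_funexp _ f); derive_rules
  | |- is_derive _ _ (fun y => @?f y `^ ?r) _ =>
      eapply (@is_derive_funpow _ f r); [cbv beta; try eassumption|derive_rules]
  | |- is_derive _ _ (fun y => y) _ => eapply is_derive_funid
  | |- _ => eassumption
  end.

Section mean_value_inequality.
Context {R : realType}.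
Implicit Types (F H f h : R -> R) (u v : R).

Lemma increment_le F H f h u v : u <= v ->
  {within `[u, v], continuous F} -> {within `[u, v], continuous H} ->
  (forall x, u < x < v -> is_derive x 1 F (f x)) ->
  (forall x, u < x < v -> is_derive x 1 H (h x)) ->
  (forall x, u < x < v -> f x <= h x) ->
  F v - F u <= H v - H u.
Proof.
move=> uv cF cH dF dH fh.
have dD x : x \in `]u, v[ -> is_derive x 1 (H - F) (h x - f x).
  rewrite in_itv/= => xuv; apply: is_deriveB; [exact: dH|exact: dF].
have cD : {within `[u, v], continuous (H - F)}.
  exact: within_continuousB.
suff : 0 <= H v - F v - (H u - F u) by lra.
move: uv; rewrite le_eqVlt => /predU1P[<-|uv]; first by rewrite subrr.
have [d duv ->] := MVT uv dD cD.
rewrite mulr_ge0// ?subr_ge0 ?(ltW uv)//; apply: fh.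
by rewrite in_itv/= in duv.
Qed.

(** The inequality replaces every estimate of an integral by a differentiation:
    [H] is an explicit antiderivative of the bound. *)
Lemma abs_increment_le F H f h u v : u <= v ->
  {within `[u, v], continuous F} -> {within `[u, v], continuous H} ->
  (forall x, u < x < v -> is_derive x 1 F (f x)) ->
  (forall x, u < x < v -> is_derive x 1 H (h x)) ->
  (forall x, u < x < v -> `|f x| <= h x) ->
  `|F v - F u| <= H v - H u.
Proof.
move=> uv cF cH dF dH fh; rewrite ler_norml; apply/andP; split.
- have cN : {within `[u, v], continuous (fun x => - H x)}.
    by move=> x; apply: cvgN; exact: cH.
  suff : - H v - - H u <= F v - F u by lra.
  apply: (@increment_le (fun x => - H x) F (fun x => - h x) f) => // x xuv.
    by apply: is_derive_funN; exact: dH.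
  by have := fh x xuv; rewrite ler_norml => /andP[].
- apply: (@increment_le _ _ f h) => // x xuv.
  by have := fh x xuv; rewrite ler_norml => /andP[].
Qed.

Lemma continuous_segment_dist f u v : {within `[u, v], continuous f} ->
  forall x, u <= x <= v -> forall e, 0 < e ->
    exists2 r, 0 < r & forall y, u <= y <= v -> `|x - y| < r -> `|f x - f y| < e.
Proof.
move=> cf x xuv e e0.
have Ax : `[u, v]%classic x by rewrite /= in_itv.
move/subspace_continuousP : cf => /(_ x Ax)/cvgrPdist_lt/(_ e e0).
move=> /nbhs_ballP[r /= r0 Hr].
exists r => // y yuv xy.
by apply: Hr => //=; rewrite in_itv.
Qed.

(** Heine's theorem on a segment, from the near-covering form of compactness:
    the uniform modulus is the index over which the covering property is
    quantified. *)
Lemma segment_uniform_continuity f u v : {within `[u, v], continuous f} ->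
  forall e, 0 < e -> exists2 r, 0 < r &
    forall x y, u <= x <= v -> u <= y <= v -> `|x - y| < r -> `|f x - f y| < e.
Proof.
move=> cf e e0.
have := @segment_compact R u v.
rewrite compact_near_coveringP.
pose P (r x : R) := u <= x <= v -> forall y, u <= y <= v -> `|x - y| < r ->
  `|f x - f y| < e.
move=> /(_ R (0^'+) P _) /=.
case.
- move=> x; rewrite in_itv/= => xuv.
  have [r r0 Hr] := continuous_segment_dist cf xuv (divr_gt0 e0 (ltr0n _ 2)).
  exists (ball x (r / 2), `]0, r / 2[%classic) => /=.
    split; first by apply: nbhsx_ballx; lra.
    by near=> z; rewrite /= in_itv/=; apply/andP; split; near: z;
      [exact: nbhs_right_gt|apply: nbhs_right_lt; lra].
  move=> [x' d] /= [xx']; rewrite in_itv/= => /andP[d0 dr] x'uv y yuv x'y.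
  have xx'r : `|x - x'| < r / 2 by exact: xx'.
  have H1 : `|f x - f x'| < e / 2 by apply: Hr => //; lra.
  have H2 : `|f x - f y| < e / 2.
    apply: Hr => //.
    have : `|x - y| <= `|x - x'| + `|x' - y| by exact: ler_distD.
    lra.
  have : `|f x' - f y| <= `|f x' - f x| + `|f x - f y| by exact: ler_distD.
  rewrite (distrC (f x') (f x)); lra.
- move=> r /= r0 Hr; exists (r / 2); first by rewrite divr_gt0.
  move=> x y xuv yuv xy; apply: (Hr (r / 2)) => //=.
  + rewrite sub0r normrN gtr0_norm; lra.
  + lra.
Unshelve. all: by end_near. Qed.

End mean_value_inequality.

(** * Sums along dyadic subdivisions *)

Section dyadic_sums.
Context {R : realType}.
Implicit Types (u v : R) (n i : nat) (f : R -> R).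

Definition dyadic u v n i : R := u + (v - u) * (i%:R / (2 ^ n)%:R).

Lemma dyadic0 u v n : dyadic u v n 0 = u.
Proof. by rewrite /dyadic mul0r mulr0 addr0. Qed.

Lemma pow2_gt0 n : 0 < (2 ^ n)%:R :> R.
Proof. by rewrite ltr0n expn_gt0. Qed.

Lemma dyadic_last u v n : dyadic u v n (2 ^ n) = v.
Proof.
by rewrite /dyadic divff ?gt_eqF ?pow2_gt0// mulr1 addrC subrK.
Qed.

Lemma dyadic_step u v n i :
  dyadic u v n i.+1 - dyadic u v n i = (v - u) / (2 ^ n)%:R.
Proof.
have n0 : (2 ^ n)%:R != 0 :> R by rewrite gt_eqF ?pow2_gt0.
by rewrite /dyadic -natr1; field.
Qed.

Lemma dyadic_mono u v n i j : u <= v -> (i <= j)%N ->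
  dyadic u v n i <= dyadic u v n j.
Proof.
move=> uv ij; rewrite /dyadic lerD2l ler_wpM2l ?subr_ge0//.
by rewrite ler_wpM2r ?invr_ge0 ?ler0n// ler_nat.
Qed.

Lemma dyadic_itv u v n i : u <= v -> (i <= 2 ^ n)%N -> u <= dyadic u v n i <= v.
Proof.
move=> uv iN; have := dyadic_mono n uv (leq0n i).
by have := dyadic_mono n uv iN; rewrite dyadic0 dyadic_last => -> ->.
Qed.

Lemma cvg_inv_pow2 : ((2 ^ n)%:R : R)^-1 @[n --> \oo] --> (0 : R).
Proof.
rewrite (_ : (fun _ => _) = geometric 1 2^-1).
  by apply: cvg_geometric; rewrite ger0_norm; lra.
by apply/funext => n; rewrite /geometric/= mul1r natrX exprVn.
Qed.

(** The summation step shared by Riemann sums and by the pathwise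
    representation of the solution: local errors that are small compared with
    the length of the cell, uniformly in its position, add up to nothing. *)
Lemma dyadic_sum_cvg0 u v (c : R -> R -> R) : u <= v ->
  (forall e, 0 < e -> exists2 r, 0 < r &
    forall x y, u <= x -> x <= y -> y <= v -> y - x < r ->
      `|c x y| <= e * (y - x)) ->
  (\sum_(i < 2 ^ n) c (dyadic u v n i) (dyadic u v n i.+1)) @[n --> \oo]
    --> (0 : R).
Proof.
move=> uv Hc; apply/cvgr0Pnorm_le => e e0.
have w0 : 0 < v - u + 1 by lra.
have [r r0 Hr] := Hc (e / (v - u + 1)) (divr_gt0 e0 w0).
have : (v - u) * ((2 ^ n)%:R : R)^-1 @[n --> \oo] --> (v - u) * 0.
  by apply: cvgMr; exact: cvg_inv_pow2.
rewrite mulr0 => /cvgr0Pnorm_lt/(_ r r0) H.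
near=> n.
have nr : (v - u) / (2 ^ n)%:R < r.
  by apply: le_lt_trans (ler_norm _) _; near: n.
apply: le_trans (ler_norm_sum _ _ _) _.
have : \sum_(i < 2 ^ n) `|c (dyadic u v n i) (dyadic u v n i.+1)| <=
    \sum_(i < 2 ^ n) e / (v - u + 1) *
      (dyadic u v n i.+1 - dyadic u v n i).
  apply: ler_sum => i _; apply: Hr.
  - by case/andP: (dyadic_itv uv (ltnW (ltn_ord i))).
  - exact: dyadic_mono.
  - by case/andP: (dyadic_itv uv (ltn_ord i)).
  - by rewrite dyadic_step.
move/le_trans; apply; rewrite -mulr_sumr.
rewrite -(big_mkord xpredT
  (fun i => dyadic u v n i.+1 - dyadic u v n i)) telescope_sumr//.
rewrite dyadic0 dyadic_last mulrAC ler_pdivrMr// ler_wpM2l// ?ltW//; lra.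
Unshelve. all: by end_near. Qed.

Lemma telescope_dyadic u v n (H : R -> R) :
  \sum_(i < 2 ^ n) (H (dyadic u v n i.+1) - H (dyadic u v n i)) = H v - H u.
Proof.
rewrite -(big_mkord xpredT
  (fun i => H (dyadic u v n i.+1) - H (dyadic u v n i))).
by rewrite (telescope_sumr (fun i => H (dyadic u v n i)))// dyadic0 dyadic_last.
Qed.

(** On a cell the error is the increment of [f x * z - Phi z], whose derivative
    is at most the oscillation of [f]. *)
Lemma dyadic_riemann_sum u v f (Phi : R -> R) : u <= v ->
  {within `[u, v], continuous f} -> {within `[u, v], continuous Phi} ->
  (forall x, u < x < v -> is_derive x 1 Phi (f x)) ->
  (\sum_(i < 2 ^ n) f (dyadic u v n i) *
     (dyadic u v n i.+1 - dyadic u v n i)) @[n --> \oo] --> Phi v - Phi u.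
Proof.
move=> uv cf cP dP.
have /dyadic_sum_cvg0 := uv.
move=> /(_ (fun x y => f x * (y - x) - (Phi y - Phi x))) H.
have {}H : (\sum_(i < 2 ^ n) (f (dyadic u v n i) *
     (dyadic u v n i.+1 - dyadic u v n i) -
     (Phi (dyadic u v n i.+1) - Phi (dyadic u v n i)))) @[n --> \oo] --> (0:R).
  apply: H => e e0; have [r r0 Hr] := segment_uniform_continuity cf e0.
  exists r => // x y ux xy yv yx.
  have subxy : `[x, y] `<=` `[u, v].
    by apply: subset_itv; rewrite bnd_simp.
  pose F z := f x * z - Phi z.
  have -> : f x * (y - x) - (Phi y - Phi x) = F y - F x by rewrite /F; ring.
  rewrite mulrBr; apply: (@abs_increment_le R F (fun z => e * z)
    (fun z => f x - f z) (fun=> e)) => //.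
  - move=> z; apply: cvgB.
      by apply: cvgMr; apply: continuous_subspaceT => w; exact: cvg_id.
    by apply: (continuous_subspaceW subxy cP).
  - by apply: continuous_subspaceT => w; apply: cvgMr; exact: cvg_id.
  - move=> z /andP[xz zy]; apply: is_derive_eq.
      apply: (is_derive_funB (is_derive_funM (is_derive_funcst (f x) z)
        (is_derive_funid z)) (dP z _)); lra.
    by rewrite /=; ring.
  - by move=> z zxy; eapply is_derive_eq; [derive_rules|rewrite /=; ring].
  - move=> z /andP[xz zy]; apply/ltW/Hr; [lra|lra|].
    by rewrite ltr_norml; lra.
rewrite -[X in _ --> X]add0r.
under eq_fun => n.
  rewrite -(subrK (Phi v - Phi u) (\sum_(i < 2 ^ n) _)).
  rewrite -{1}(telescope_dyadic u v n Phi) -sumrB; over.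
by apply: cvgD; [exact: H|exact: cvg_cst].
Qed.

End dyadic_sums.

(** * Duality with the backward system *)

Section adjoint_representation.
Context {R : realType}.
Notation mu := (@lebesgue_measure R).
Implicit Types (a b sigma t u v s : R) (p q x bm : R -> R).

(** Backward system dual to the drift of the pair [(I, X)], where [I] is the
    running integral of [X]: without noise [p I + q X] would be constant, and
    the values at time [t] make it equal to [X t] there.  As a function of [s],
    [q] is the resolvent of the equation from time [s] to time [t]. *)
Definition adjoint_pair a b t p q : Prop :=
  [/\ p t = 0, q t = 1,
      forall s, 0 <= s <= t -> is_derive s 1 p (- (b / (1 + s) * q s)) &
      forall s, 0 <= s <= t -> is_derive s 1 q (- p s - a * q s)].

Lemma is_derive_within_continuous u v (f df : R -> R) :
  (forall s, u <= s <= v -> is_derive s 1 f (df s)) ->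
  {within `[u, v], continuous f}.
Proof.
move=> fd; apply: derivable_within_continuous => s; rewrite in_itv/= => suv.
by have /@ex_derive := fd s suv.
Qed.

Lemma segment_bounded u v (f : R -> R) : {within `[u, v], continuous f} ->
  exists2 M, 0 < M & forall s, u <= s <= v -> `|f s| <= M.
Proof.
move=> cf; have [uv|vu] := leP u v; last first.
  by exists 1 => // s; lra.
have cn : {within `[u, v], continuous (fun s => `|f s|)}.
  by move=> s; apply: cvg_norm; exact: cf.
have [c cuv Hc] := EVT_max uv cn.
exists (`|f c| + 1); first by rewrite ltr_wpDl.
by move=> s suv; rewrite (le_trans (Hc s _))// ?lerDl// in_itv.
Qed.

Lemma within_segment_interior u v (f : R -> R) s :
  {within `[u, v], continuous f} -> u < s < v -> {for s, continuous f}.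
Proof.
move=> cf suv; apply: (@within_continuous_continuous _ _ _ u v) => //.
lra.
Qed.

Lemma primitive_is_derive (f : R -> R) u v s :
  {within `[u, v], continuous f} -> u < s < v ->
  is_derive s 1 (fun z => (\int[mu]_(r in `[u, z]) f r)%R) (f s).
Proof.
move=> cf /andP[us sv].
have [|||df <-] := @continuous_FTC1_closed _ f u s v sv.
- exact: (continuous_compact_integrable (@segment_compact _ _ _) cf).
- done.
- by apply: (within_segment_interior cf); rewrite us.
- by rewrite derive1E; apply: derivableP.
Qed.

Lemma primitive_continuous (f : R -> R) u v : u <= v -> {within `[u, v], continuous f} ->
  {within `[u, v], continuous (fun z => (\int[mu]_(r in `[u, z]) f r)%R)}.
Proof.
move=> uv cf; apply: parameterized_integral_continuous => //.
exact: (continuous_compact_integrable (@segment_compact _ _ _) cf).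
Qed.

(** Along a solution path the pairing [p I + q X] with the backward system has
    increments [sigma q dB] up to the oscillation of the driving path on each
    cell: once the noise is frozen at the right end of the cell, the drift
    terms cancel exactly. *)
Lemma adjoint_path_sums a b sigma t p q x bm u v : 0 < t ->
  0 <= u -> u <= v -> v <= t ->
  adjoint_pair a b t p q ->
  {within `[-1, +oo[, continuous x} ->
  {within `[0, +oo[, continuous bm} ->
  (forall s, 0 <= s -> x s = x 0 +
    \int[mu]_(u in `[0, s]) (a * x u + b / (1 + u) *
       \int[mu]_(r in `[-1, u]) x r) + sigma * (bm s - bm 0)) ->
  (\sum_(i < 2 ^ n) sigma * (q (dyadic u v n i) *
     (bm (dyadic u v n i.+1) - bm (dyadic u v n i)))) @[n --> \oo] -->
  (p v * (\int[mu]_(r in `[-1, v]) x r)%R + q v * x v) -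
  (p u * (\int[mu]_(r in `[-1, u]) x r)%R + q u * x u).
Proof.
move=> t0 u0 uv vt [pt qt dp dq] cx cbm eqx.
pose I z := (\int[mu]_(r in `[-1, z]) x r)%R.
have dI s : 0 <= s -> is_derive s 1 I (x s).
  move=> s0; apply: (@primitive_is_derive _ _ (s + 1)); last by lra.
  by apply: continuous_subspaceW cx; apply: subset_itvl; rewrite bnd_simp.
have cx0 : {within `[0, t], continuous x}.
  apply: continuous_subspaceW cx => z /=; rewrite !in_itv/= => /andP[z0 zt].
  by rewrite andbT; lra.
have cbm0 : {within `[0, t], continuous bm}.
  apply: continuous_subspaceW cbm => z /=.
  by rewrite !in_itv/= => /andP[->].
have cI : {within `[0, t], continuous I}.
  by apply: (is_derive_within_continuous (df := x)) => s /andP[s0 _]; exact: dI.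
have cp : {within `[0, t], continuous p} := is_derive_within_continuous dp.
have cq : {within `[0, t], continuous q} := is_derive_within_continuous dq.
pose g z := a * x z + b / (1 + z) * I z.
have cb : {within `[0, t], continuous (fun z => b / (1 + z))}.
  apply: (is_derive_within_continuous (df := fun z => b * - (1 / (1 + z) ^+ 2))).
  move=> s /andP[s0 _]; have s1 : 1 + s != 0 by rewrite gt_eqF//; lra.
  by eapply is_derive_eq; [derive_rules|rewrite /=; field].
have cg : {within `[0, t], continuous g}.
  move=> s; apply: cvgD; first by apply: cvgMr; exact: cx0.
  by apply: cvgM; [exact: cb|exact: cI].
pose Q z := (\int[mu]_(r in `[0, z]) g r)%R.
have cQ : {within `[0, t], continuous Q} := primitive_continuous (ltW t0) cg.
have dQ s : 0 < s < t -> is_derive s 1 Q (g s).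
  exact: primitive_is_derive.
pose W z := bm z - bm 0.
have xE s : 0 <= s -> x s = x 0 + Q s + sigma * W s by move=> /eqx.
pose H z := p z * I z + q z * x z.
have [M M0 HM] : exists2 M, 0 < M &
    forall s, 0 <= s <= t -> `|- p s - a * q s| <= M.
  apply: segment_bounded => s; apply: cvgB; first by apply: cvgN; exact: cp.
  by apply: cvgMr; exact: cq.
pose c y z := H z - H y - sigma * (q y * (bm z - bm y)).
have c0 : (\sum_(i < 2 ^ n) c (dyadic u v n i) (dyadic u v n i.+1)) @[n --> \oo]
    --> (0 : R).
  apply: dyadic_sum_cvg0 => // e e0.
  have s0 : 0 < (`|sigma| + 1) * M by rewrite mulr_gt0// ltr_wpDl.
  have [r r0 Hr] := segment_uniform_continuity cbm0 (divr_gt0 e0 s0).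
  exists r => // y z uy yz zv zyr.
  have y0 : 0 <= y by lra.
  have zt : z <= t by lra.
  have sub : `[y, z] `<=` `[0, t] by apply: subset_itv; rewrite bnd_simp.
  (* The path with the noise frozen at time [z]: unlike [H], it is
     differentiable. *)
  pose D s := p s * I s + q s * (x 0 + Q s) + sigma * W z * q s.
  have -> : c y z = D z - D y.
    rewrite /c /D /H (xE y y0) (xE z (le_trans y0 yz)).
    have -> : bm z - bm y = W z - W y by rewrite /W; lra.
    ring.
  rewrite mulrBr; apply: (@abs_increment_le R D (fun z => e * z)
    (fun s => sigma * (W z - W s) * (- p s - a * q s)) (fun=> e)) => //.
  - apply: (continuous_subspaceW sub) => s.
    apply: cvgD; last by apply: cvgMr; exact: cq.
    apply: cvgD; first by apply: cvgM; [exact: cp|exact: cI].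
    apply: cvgM; first exact: cq.
    by apply: cvgD; [exact: cvg_cst|exact: cQ].
  - by apply: continuous_subspaceT => w; apply: cvgMr; exact: cvg_id.
  - move=> s /andP[ys sz].
    have st : 0 <= s <= t by lra.
    have s0t : 0 < s < t by lra.
    have := dp s st; have := dq s st; have := dQ s s0t.
    have := dI s (ltac:(lra)) => dIs dQs dqs dps.
    eapply is_derive_eq; first by rewrite /D; derive_rules.
    rewrite /= [x s]xE /g; last by lra.
    have s1 : 1 + s != 0 by rewrite gt_eqF//; lra.
    by rewrite [x s]xE; [field|lra].
  - by move=> s sz; eapply is_derive_eq; [derive_rules|rewrite /=; ring].
  - move=> s /andP[ys sz].
    have Ws : `|W z - W s| <= e / ((`|sigma| + 1) * M).
      have -> : W z - W s = bm z - bm s by rewrite /W; lra.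
      by apply/ltW/Hr; [lra|lra|rewrite ger0_norm; lra].
    have Hs := HM s (ltac:(lra)).
    rewrite !normrM.
    have : `|sigma| * `|W z - W s| * `|- p s - a * q s| <=
        `|sigma| * (e / ((`|sigma| + 1) * M)) * M.
      by rewrite !ler_pM// ?mulr_ge0.
    move/le_trans; apply.
    have -> : `|sigma| * (e / ((`|sigma| + 1) * M)) * M =
        `|sigma| / (`|sigma| + 1) * e.
      have s1 : `|sigma| + 1 != 0 by rewrite gt_eqF// ltr_wpDl.
      by field; rewrite s1 gt_eqF.
    rewrite ler_piMl ?(ltW e0)// ler_pdivrMr ?ltr_wpDl// mul1r lerDl//.
rewrite -/(I v) -/(I u) -/(H v) -/(H u) -[X in _ --> X]subr0.
rewrite (_ : (fun n => _) = fun n => H v - H u -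
    \sum_(i < 2 ^ n) c (dyadic u v n i) (dyadic u v n i.+1)); last first.
  apply/funext => n; rewrite -(telescope_dyadic u v n H) -sumrB.
  by apply: eq_bigr => i _; rewrite /c subKr.
by apply: cvgB; [exact: cvg_cst|exact: c0].
Qed.

End adjoint_representation.

(** * Existence of solutions of the backward system *)

Section adjoint_existence.
Context {R : realType}.
Implicit Types (u c : nat -> R) (L K a b t : R).

(** The ratio condition is chosen to be stable under termwise differentiation
    of the power series. *)
Definition ratio_bounded L u := exists2 C, 0 <= C &
  forall k, 0 <= u k /\ u k.+1 <= (L + C / k.+1%:R) * u k.

Lemma ratio_bounded_diffs L u : 0 <= L -> ratio_bounded L u ->
  ratio_bounded L (pseries_diffs u).
Proof.
move=> L0 [C C0 Hu]; exists (C + C + L); first by rewrite !addr_ge0.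
move=> k; rewrite /pseries_diffs; split.
  by rewrite mulr_ge0//; case: (Hu k.+1).
have [u0 /(ler_wpM2l (ler0n R k.+2))] := Hu k.+1; move/le_trans; apply.
rewrite !mulrA ler_wpM2r//.
have k1 : 1 <= k.+1%:R :> R by rewrite ler1n.
have -> : k.+2%:R = k.+1%:R + 1 :> R by rewrite -natr1.
move: k.+1%:R k1 => z z1.
have -> : (z + 1) * (L + C / (z + 1)) = z * L + L + C.
  by field; rewrite gt_eqF//; lra.
have -> : (L + (C + C + L) / z) * z = L * z + (C + C + L).
  by field; rewrite gt_eqF//; lra.
lra.
Qed.

Lemma ratio_bounded_cvg L u K : 0 <= L -> 0 < K -> L * K < 1 ->
  ratio_bounded L u -> cvgn (pseries u K).
Proof.
move=> L0 K0 LK [C C0 Hu].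
have : C * K * (k.+1%:R)^-1 @[k --> \oo] --> C * K * 0.
  by apply: cvgMr; exact: cvg_harmonic.
rewrite mulr0; pose d := (1 - L * K) / 2.
have d0 : 0 < d by rewrite /d; lra.
move=> /cvgr0Pnorm_lt/(_ _ d0) [N _ HN].
pose r := (1 + L * K) / 2.
have r0 : 0 <= r by rewrite /r; nra.
have r1 : r < 1 by rewrite /r; lra.
have step k : (N <= k)%N -> u k.+1 * K ^+ k.+1 <= r * (u k * K ^+ k).
  move=> Nk; have [u0 uS] := Hu k.
  have /(le_lt_trans (ler_norm _)) := HN k Nk; rewrite /= => Hk.
  have : u k.+1 * K ^+ k.+1 <= (L + C / k.+1%:R) * u k * K ^+ k.+1.
    by rewrite ler_wpM2r// exprn_ge0// ltW.
  move/le_trans; apply; rewrite exprS.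
  have -> : (L + C / k.+1%:R) * u k * (K * K ^+ k) =
      (L * K + C * K / k.+1%:R) * (u k * K ^+ k).
    by field; rewrite ?natr1 ?nat1r pnatr_eq0.
  rewrite ler_wpM2r ?mulr_ge0 ?exprn_ge0 ?(ltW K0)//.
  by move: Hk; rewrite /r /d; move: (C * K / _) (L * K) => z w; lra.
have bound k : u (N + k)%N * K ^+ (N + k) <= geometric (u N * K ^+ N) r k.
  elim: k => [|k IH]; first by rewrite /geometric/= expr0 mulr1 addn0.
  rewrite addnS; apply: le_trans (step _ (leq_addr _ _)) _.
  by rewrite /geometric/= exprS [leRHS]mulrCA ler_wpM2l.
have u_ge0 k : 0 <= u k * K ^+ k.
  by rewrite mulr_ge0 ?exprn_ge0 ?(ltW K0)//; case: (Hu k).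
rewrite /pseries -(is_cvg_series_restrict N).
rewrite (_ : (fun n => _) = fun n => (if (n < N)%N then 0 else
  series (fun k => u (N + k)%N * K ^+ (N + k)) (n - N)%N)); last first.
  apply/funext => n; case: ltnP => nN; first by rewrite big_geq// ltnW.
  rewrite /series/= -{1}(add0n N) -{1}(subnK nN) big_addn addnK.
  by apply: eq_bigr => i _; rewrite addnC.
have H : cvgn (series (fun k => u (N + k)%N * K ^+ (N + k))).
  apply: (series_le_cvg _ _ bound) => //.
  - by move=> k; rewrite /geometric/= mulr_ge0 ?exprn_ge0.
  - by apply: is_cvg_geometric_series; rewrite ger0_norm.
apply/cvg_ex; exists (limn (series (fun k => u (N + k)%N * K ^+ (N + k)))).
rewrite -(cvg_shiftn N).
rewrite [X in X @ _](_ : _ = series (fun k => u (N + k)%N * K ^+ (N + k))).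
  exact: H.
by apply/funext => n /=; rewrite ltnNge leq_addl/= addnK.
Qed.

Lemma ratio_bounded_is_cvg_pseries L u c K : 0 <= L -> 0 < K -> L * K < 1 ->
  (forall k, `|c k| <= u k) -> ratio_bounded L u -> cvgn (pseries c K).
Proof.
move=> L0 K0 LK cu Hu; have := ratio_bounded_cvg L0 K0 LK Hu.
rewrite /pseries => H; apply: normed_cvg; apply: series_le_cvg H.
- by move=> k /=; exact: normr_ge0.
- by move=> k /=; rewrite mulr_ge0 ?exprn_ge0 ?(ltW K0)// (le_trans _ (cu k)).
- move=> k /=; rewrite normrM normrX (gtr0_norm K0) ler_wpM2r//.
  by rewrite exprn_ge0// ltW.
Qed.

Lemma ratio_bounded_is_derive L u c K x : 0 <= L -> L * K < 1 -> `|x| < K ->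
  (forall k, `|c k| <= u k) -> ratio_bounded L u ->
  [/\ cvgn (pseries c x), cvgn (pseries (pseries_diffs c) x) &
    is_derive x (1 : R) (fun z => limn (pseries c z))
      (limn (pseries (pseries_diffs c) x))].
Proof.
move=> L0 LK xK cu Hu.
have K0 : 0 < K by rewrite (le_lt_trans _ xK).
have cu1 k : `|pseries_diffs c k| <= pseries_diffs u k.
  by rewrite /pseries_diffs normrM ger0_norm// ler_wpM2l.
have cu2 k : `|pseries_diffs (pseries_diffs c) k| <=
    pseries_diffs (pseries_diffs u) k.
  rewrite -[leLHS]/(`|k.+1%:R * pseries_diffs c k.+1|) normrM ger0_norm//.
  exact: ler_wpM2l.
have Hu1 := ratio_bounded_diffs L0 Hu.
have Hu2 := ratio_bounded_diffs L0 Hu1.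
have xK' : `|x| < `|K| by rewrite (gtr0_norm K0).
have c0 := ratio_bounded_is_cvg_pseries L0 K0 LK cu Hu.
have c1 := ratio_bounded_is_cvg_pseries L0 K0 LK cu1 Hu1.
have c2 := ratio_bounded_is_cvg_pseries L0 K0 LK cu2 Hu2.
split.
- exact: is_cvg_pseries_inside c0 xK'.
- exact: is_cvg_pseries_inside c1 xK'.
- exact: pseries_snd_diffs c0 c1 c2 xK'.
Qed.

(** Taylor coefficients of the backward system at the terminal time, in the
    elapsed time [t - s]; the first component is [p], the second is [q]. *)
Fixpoint adjoint_coef a b t (k : nat) : R * R :=
  if k is j.+1 then
    let: (pj, qj) := adjoint_coef a b t j in
    ((j%:R * pj + b * qj) / ((1 + t) * j.+1%:R), (pj + a * qj) / j.+1%:R)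
  else (0, 1).

(** The only singularity of the backward system is at time [-1], so the Taylor
    series at time [t] has radius [1 + t] and reaches all of [0, t]. *)
Lemma adjoint_pair_exists a b t : 0 <= t -> exists p q, adjoint_pair a b t p q.
Proof.
move=> t0; pose x0 := 1 + t; have x00 : 0 < x0 by rewrite /x0; lra.
pose P k := (adjoint_coef a b t k).1; pose Q k := (adjoint_coef a b t k).2.
have PS k : P k.+1 = (k%:R * P k + b * Q k) / (x0 * k.+1%:R).
  by rewrite /P /Q /=; case: (adjoint_coef a b t k).
have QS k : Q k.+1 = (P k + a * Q k) / k.+1%:R.
  by rewrite /P /Q /=; case: (adjoint_coef a b t k).
pose u k := `|P k| + `|Q k|.
have Hu : ratio_bounded x0^-1 u.
  exists (1 + `|a| + `|b| / x0).
    by rewrite !addr_ge0// divr_ge0// ltW.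
  move=> k; split; first by rewrite addr_ge0.
  have k0 : 0 < k.+1%:R :> R by rewrite ltr0n.
  rewrite /u PS QS !normrM !normfV normrM !(gtr0_norm k0) (gtr0_norm x00).
  have h1 : `|k%:R * P k + b * Q k| <= k.+1%:R * `|P k| + `|b| * `|Q k|.
    rewrite (le_trans (ler_normD _ _))// !normrM lerD2r ler_wpM2r//.
    by rewrite ger0_norm// ler_nat.
  have h2 : `|P k + a * Q k| <= `|P k| + `|a| * `|Q k|.
    by rewrite (le_trans (ler_normD _ _))// !normrM.
  have h3 : `|k%:R * P k + b * Q k| / (x0 * k.+1%:R) <=
      (k.+1%:R * `|P k| + `|b| * `|Q k|) / (x0 * k.+1%:R).
    by rewrite ler_wpM2r// invr_ge0 mulr_ge0// ltW.
  have h4 : `|P k + a * Q k| / k.+1%:R <= (`|P k| + `|a| * `|Q k|) / k.+1%:R.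
    by rewrite ler_wpM2r.
  apply: le_trans (lerD h3 h4) _; rewrite -subr_ge0.
  have -> : (x0^-1 + (1 + `|a| + `|b| / x0) / k.+1%:R) * (`|P k| + `|Q k|) -
    ((k.+1%:R * `|P k| + `|b| * `|Q k|) / (x0 * k.+1%:R) +
       (`|P k| + `|a| * `|Q k|) / k.+1%:R) =
    `|Q k| / x0 + (`|a| + `|b| / x0) / k.+1%:R * `|P k| + `|Q k| / k.+1%:R.
    by field; rewrite ?natr1 ?nat1r !gt_eqF.
  apply: addr_ge0; last exact: divr_ge0.
  apply: addr_ge0; first by rewrite divr_ge0// ltW.
  apply: mulr_ge0 => //; rewrite divr_ge0// addr_ge0// divr_ge0// ltW//.
have L0 : 0 <= x0^-1 by rewrite invr_ge0 ltW.
pose K := t + 1 / 2; have LK : x0^-1 * K < 1.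
  by rewrite mulrC ltr_pdivrMr// mul1r /K /x0; lra.
have Pu k : `|P k| <= u k by rewrite lerDl.
have Qu k : `|Q k| <= u k by rewrite lerDr.
have HP z (zK : `|z| < K) := ratio_bounded_is_derive L0 LK zK Pu Hu.
have HQ z (zK : `|z| < K) := ratio_bounded_is_derive L0 LK zK Qu Hu.
have eqQ z : `|z| < K -> limn (pseries (pseries_diffs Q) z) =
    limn (pseries P z) + a * limn (pseries Q z).
  move=> zK; have [cP _ _] := HP z zK; have [cQ _ _] := HQ z zK.
  rewrite (_ : pseries (pseries_diffs Q) z =
    (fun n => pseries P z n + a * pseries Q z n)); last first.
    apply/funext => n; rewrite /pseries /series/= mulr_sumr -big_split/=.
    apply: eq_bigr => i _; rewrite /pseries_diffs QS; field.
    by rewrite ?natr1 ?nat1r pnatr_eq0.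
  by apply/cvg_lim => //; apply: cvgD; [exact: cP|apply: cvgMr; exact: cQ].
have eqP z : `|z| < K -> (x0 - z) * limn (pseries (pseries_diffs P) z) =
    b * limn (pseries Q z).
  move=> zK; have [cP cP' _] := HP z zK; have [cQ _ _] := HQ z zK.
  have : x0 * limn (pseries (pseries_diffs P) z) =
      z * limn (pseries (pseries_diffs P) z) + b * limn (pseries Q z).
    have H1 : (fun n => x0 * pseries (pseries_diffs P) z n) @ \oo -->
        x0 * limn (pseries (pseries_diffs P) z).
      by apply: cvgMr; exact: cP'.
    rewrite -(cvg_lim _ H1)//; apply/cvg_lim => //.
    rewrite (_ : (fun n => x0 * _) = fun n =>
      z * series (fun i => i%:R * P i * z ^+ i.-1) n + b * pseries Q z n).
      apply: cvgD; last by apply: cvgMr; exact: cQ.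
      by apply: cvgMr; exact: pseries_diffs_equiv.
    apply/funext => n; rewrite /pseries /series/= !mulr_sumr -big_split/=.
    apply: eq_bigr => -[|i] _; rewrite /pseries_diffs PS.
      by rewrite expr0; field; rewrite gt_eqF.
    rewrite /= exprS; have := pnatr_eq0 R i.+2.
    by move: i.+2%:R => w /= w0; field; rewrite w0 (gt_eqF x00).
  by move=> E; rewrite mulrBl E; ring.
exists (fun s => limn (pseries P (t - s))), (fun s => limn (pseries Q (t - s))).
have at0 c : limn (pseries c 0) = c 0%N.
  apply: lim_near_cst => //; near=> n.
  have n0 : (0 < n)%N by near: n; exists 1%N.
  rewrite /pseries /series/= -(prednK n0) big_nat_recl//= big1 ?addr0.
    by rewrite expr0 mulr1.
  by move=> i _; rewrite exprS mul0r mulr0.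
have ts s : 0 <= s <= t -> `|t - s| < K.
  by move=> st; rewrite ger0_norm /K; lra.
split; [by rewrite subrr at0|by rewrite subrr at0| |].
- move=> s st; have [_ _ dP] := HP _ (ts s st).
  have s1 : 1 + s != 0 by rewrite gt_eqF//; lra.
  apply: is_derive_eq.
    exact: (@is_derive1_comp _ (fun z => limn (pseries P z)) (fun s => t - s)
      s _ _ dP (is_derive_funB (is_derive_funcst t s) (is_derive_funid s))).
  have := eqP _ (ts s st); have -> : x0 - (t - s) = 1 + s by rewrite /x0; lra.
  by move=> E; apply: (mulfI s1); rewrite mulrA E; field.
- move=> s st; have [_ _ dQ] := HQ _ (ts s st).
  apply: is_derive_eq.
    exact: (@is_derive1_comp _ (fun z => limn (pseries Q z)) (fun s => t - s)
      s _ _ dQ (is_derive_funB (is_derive_funcst t s) (is_derive_funid s))).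
  by rewrite eqQ; [ring|exact: ts].
Unshelve. all: by end_near. Qed.
End adjoint_existence.

(** * Decay of the resolvent when [a + b < 0] *)

Section adjoint_decay.
Context {R : realType}.
Implicit Types (a b t s g : R) (p q : R -> R).

(** Lets a linear factor in [t - s] be absorbed by part of the exponential
    decay. *)
Lemma linear_le_expR (c z : R) : 0 < c -> 0 <= z -> 1 + z <= (1 + c^-1) * expR (c * z).
Proof.
move=> c0 z0; have := expR_ge1Dx (c * z) => h.
have c1 : 0 <= 1 + c^-1 by rewrite addr_ge0// invr_ge0 ltW.
apply: le_trans (ler_wpM2l c1 h); rewrite mulrDr mulr1 mulrDl mul1r mulKf ?gt_eqF//.
have := mulr_ge0 (ltW c0) z0; have : 0 <= c^-1 by rewrite invr_ge0 ltW.
lra.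
Qed.

Lemma powRB1 (x r : R) : 0 < x -> x `^ (r - 1) = x `^ r / x.
Proof.
move=> x0; rewrite powRB; first by rewrite powRr1// ltW.
by rewrite (gt_eqF x0) implybT.
Qed.

(** Moving the weight [(1 + r)^{2g-2}] from time [r] to time [t] costs at most
    a factor [(1 + (t - r))^2], which half of the exponential absorbs. *)
Lemma forcing_weight_bound a g r t : a < 0 -> 0 < g -> 0 <= r <= t ->
  (1 + r) `^ (2 * g) / (1 + r) ^+ 2 * expR (a * (t - r)) <=
  (1 + t) `^ (2 * g) / (1 + t) ^+ 2 *
    ((1 + (- a / 4)^-1) ^+ 2 * expR (a / 2 * (t - r))).
Proof.
move=> a0 g0 /andP[r0 rt].
have tr0 : 0 <= t - r by lra.
have x1 : 0 < 1 + r by lra.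
have t1 : 0 < 1 + t by lra.
have xW : (1 + r) `^ (2 * g) / (1 + r) ^+ 2 <=
    (1 + t) `^ (2 * g) / (1 + t) ^+ 2 * (1 + (t - r)) ^+ 2.
  have g20 : 0 <= 2 * g by lra.
  have xg : (1 + r) `^ (2 * g) <= (1 + t) `^ (2 * g).
    by apply: (ge0_ler_powR g20); rewrite ?nnegrE ?(ltW x1) ?(ltW t1) ?lerD2l.
  have xt : (1 + t) / (1 + r) <= 1 + (t - r).
    rewrite ler_pdivrMr// -subr_ge0.
    have -> : (1 + (t - r)) * (1 + r) - (1 + t) = (t - r) * r by ring.
    by rewrite mulr_ge0.
  have xt0 : 0 <= (1 + t) / (1 + r) by rewrite divr_ge0// ltW.
  have xt2 : ((1 + t) / (1 + r)) ^+ 2 <= (1 + (t - r)) ^+ 2.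
    by rewrite lerXn2r// nnegrE// (le_trans xt0 xt).
  have -> : (1 + r) `^ (2 * g) / (1 + r) ^+ 2 =
      (1 + r) `^ (2 * g) / (1 + t) ^+ 2 * ((1 + t) / (1 + r)) ^+ 2.
    by field; rewrite !gt_eqF.
  apply: ler_pM => //.
  - by rewrite divr_ge0 ?powR_ge0// exprn_ge0// ltW.
  - exact: sqr_ge0.
  - by rewrite ler_wpM2r// invr_ge0 exprn_ge0// ltW.
apply: le_trans (ler_wpM2r (expR_ge0 _) xW) _.
rewrite -[leLHS]mulrA; apply: ler_wpM2l.
  by rewrite divr_ge0 ?powR_ge0// exprn_ge0// ltW.
have al4 : 0 < - a / 4 by lra.
have h := linear_le_expR al4 tr0.
have h2 : (1 + (t - r)) ^+ 2 <=
    ((1 + (- a / 4)^-1) * expR (- a / 4 * (t - r))) ^+ 2.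
  have h0 : 0 <= 1 + (t - r) by lra.
  by rewrite lerXn2r// nnegrE// (le_trans h0 h).
apply: le_trans (ler_wpM2r (expR_ge0 _) h2) _.
rewrite exprMn -[leLHS]mulrA; apply: ler_wpM2l; first exact: sqr_ge0.
rewrite -expRM_natl -expRD ler_expR; lra.
Qed.

(** Backwards in time the pair [(p, q - e^{a(t-s)})] starts from rest and is
    forced by [e^{a(t-s)}] with a gain [b / (1 + s)].  In the coordinates
    [(p, p + a (q - e^{a(t-s)}))] the second component is strongly damped, and
    where it vanishes the unforced first one solves
    [p' = - (b / |a|) p / (1 + s)], so it is of order [(1 + s)^{- b / |a|}].
    The sum of squares is therefore controlled by an integrating factor close
    to [(1 + s)^{2g}]. *)
Lemma adjoint_energy_bound a b g : a < 0 -> b / - a <= g -> 0 < g ->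
  exists2 K, 0 <= K & forall t p q, 0 <= t -> adjoint_pair a b t p q ->
    forall s, 0 <= s <= t ->
      (q s - expR (a * (t - s))) ^+ 2 <=
      K * ((1 + t) `^ (2 * g) / (1 + t) ^+ 2) / (1 + s) `^ (2 * g).
Proof.
move=> a0 bg g0; pose al := - a; have al0 : 0 < al by rewrite /al; lra.
pose be := b / al; pose c := be ^+ 2 / (2 * al).
have c0 : 0 <= c by rewrite divr_ge0 ?sqr_ge0// mulr_ge0// ltW.
pose C := (1 + (al / 4)^-1) ^+ 2.
pose D := 2 * b ^+ 2 * expR al^-1 * C.
have D0 : 0 <= D.
  by rewrite /D /C mulr_ge0 ?sqr_ge0// mulr_ge0 ?expR_ge0// mulr_ge0 ?sqr_ge0.
exists (2 / al ^+ 2 * (expR c * (D * (2 / al)))).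
  by rewrite mulr_ge0 ?divr_ge0 ?exprn_ge0 ?(ltW al0)// mulr_ge0 ?expR_ge0//
    mulr_ge0// divr_ge0// ltW.
move=> t p q t0 [pt qt dp dq] s /andP[s0 st].
pose E s := expR (a * (t - s)).
have E1 r : 0 <= r <= t -> E r <= 1.
  by move=> rt; rewrite -expR0 ler_expR; nra.
pose rho r := q r - E r; pose eta r := p r + a * rho r.
pose V r := p r ^+ 2 + eta r ^+ 2.
(* The factor [exp (- c / (1 + r))] keeps the coefficient of [eta ^ 2] in the
   energy balance nonnegative when [b < 0], and [exp (E r / al)] pays for the
   terms linear in the forcing. *)
pose m r := (1 + r) `^ (2 * g) * expR (- (c / (1 + r))) * expR (E r / al).
pose W := (1 + t) `^ (2 * g) / (1 + t) ^+ 2.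
have W0 : 0 <= W by rewrite divr_ge0 ?powR_ge0 ?exprn_ge0//; lra.
pose H r := D * W * (2 / al * expR (a / 2 * (t - r))).
pose v r := 2 * p r * (- (b / (1 + r) * q r)) +
  2 * eta r * (- (b / (1 + r) * q r) + a * (- p r - a * rho r)).
have dE (r : R) : is_derive r 1 E (- a * E r).
  by eapply is_derive_eq; [rewrite /E; derive_rules|rewrite /E; ring].
have dV (r : R) : 0 <= r <= t -> is_derive r 1 V (v r).
  move=> rt; have := dp r rt; have := dq r rt; have := dE r => dEr dqr dpr.
  eapply is_derive_eq; first by rewrite /V /eta /rho; derive_rules.
  rewrite /v /eta /rho /=; ring.
have dm (r : R) : 0 <= r <= t ->
    is_derive r 1 m (m r * (2 * g / (1 + r) + c / (1 + r) ^+ 2 + E r)).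
  move=> rt; have := dE r => dEr; have r1 : 0 < 1 + r by lra.
  have r10 : 1 + r != 0 by rewrite gt_eqF.
  eapply is_derive_eq; first by rewrite /m; derive_rules.
  rewrite /= powRB1// /m; move: (E r) (expR _) (expR _) (_ `^ _) => w x y z.
  rewrite /al; field; rewrite r10 lt_eqF//.
have al2 : 0 < al ^+ 2 by rewrite exprn_gt0.
have s1 : 1 <= 1 + s by lra.
have s0' : 0 < (1 + s) `^ (2 * g) by rewrite powR_gt0//; lra.
suff HV : V s * m s <= H t - H s.
  have mge : (1 + s) `^ (2 * g) * expR (- c) <= m s.
    rewrite /m -mulrA ler_wpM2l ?(ltW s0')//.
    rewrite -[leLHS]mulr1 ler_pM ?expR_ge0//.
      by rewrite ler_expR lerN2 ler_pdivrMr ?ler_peMr//; lra.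
    by rewrite -expR0 ler_expR divr_ge0 ?expR_ge0// ltW.
  have V0 : 0 <= V s by rewrite addr_ge0 ?sqr_ge0.
  have Hts : H t - H s <= D * W * (2 / al).
    rewrite /H subrr mulr0 expR0 mulr1 lerBlDr lerDl.
    apply: mulr_ge0; first exact: mulr_ge0.
    by apply: mulr_ge0; [rewrite divr_ge0// ltW|exact: expR_ge0].
  have V1 : V s * ((1 + s) `^ (2 * g) * expR (- c)) <= D * W * (2 / al).
    by apply: le_trans Hts; apply: le_trans HV; rewrite ler_wpM2l.
  have rhoV : rho s ^+ 2 <= 2 / al ^+ 2 * V s.
    rewrite mulrAC ler_pdivlMr// /V /eta /al.
    rewrite -subr_ge0.
    have -> : 2 * (p s ^+ 2 + (p s + a * rho s) ^+ 2) - rho s ^+ 2 * (- a) ^+ 2 =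
      (2 * p s + a * rho s) ^+ 2 by ring.
    exact: sqr_ge0.
  apply: le_trans rhoV _.
  have -> : 2 / al ^+ 2 * (expR c * (D * (2 / al))) *
      ((1 + t) `^ (2 * g) / (1 + t) ^+ 2) / (1 + s) `^ (2 * g) =
    2 / al ^+ 2 * ((D * W * (2 / al)) / ((1 + s) `^ (2 * g) * expR (- c))).
    rewrite /W expRN; field.
    by rewrite !gt_eqF ?expR_gt0//; lra.
  rewrite ler_wpM2l ?divr_ge0 ?(ltW al2)// ler_pdivlMr//.
  by rewrite mulr_gt0 ?expR_gt0.
have VmE : V s * m s = - (V t * m t) - - (V s * m s).
  have -> : V t = 0.
    by rewrite /V /eta /rho /E pt qt subrr mulr0 expR0 subrr; ring.
  ring.
rewrite VmE.
pose M r := m r * (2 * g / (1 + r) + c / (1 + r) ^+ 2 + E r).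
apply: (@increment_le R (fun r => - (V r * m r)) H
  (fun r => - (V r * M r + m r * v r))
  (fun r => D * W * expR (a / 2 * (t - r)))) => //.
- apply: (is_derive_within_continuous (df := fun r => - (V r * M r + m r * v r))).
  move=> r rt; apply: is_derive_funN; apply: is_derive_funM.
    by apply: dV; lra.
  by apply: dm; lra.
- apply: (is_derive_within_continuous (df := fun r => D * W * expR (a / 2 * (t - r)))).
  move=> r _; eapply is_derive_eq; first by rewrite /H; derive_rules.
  by rewrite /= /al; field; rewrite lt_eqF.
- move=> r rt; apply: is_derive_funN; apply: is_derive_funM.
    by apply: dV; lra.
  by apply: dm; lra.
- move=> r _; eapply is_derive_eq; first by rewrite /H; derive_rules.
  by rewrite /= /al; field; rewrite lt_eqF.
move=> r /andP[sr rt]; have r1 : 1 <= 1 + r by lra.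
have m0 : 0 <= m r by rewrite !mulr_ge0 ?powR_ge0 ?expR_ge0.
have Er0 : 0 <= E r by exact: expR_ge0.
pose x := 1 + r; have x1 : 1 <= x by [].
have xn : x != 0 by rewrite gt_eqF//; lra.
have an : a != 0 by rewrite lt_eqF.
have aln : al != 0 by rewrite gt_eqF.
have key : - (v r + V r * (2 * g / x + c / x ^+ 2 + E r)) <= 2 * b ^+ 2 / x ^+ 2 * E r.
  rewrite -subr_ge0.
  (* The terms linear in the forcing complete the squares with [E r] times the
     energy. *)
  have -> : 2 * b ^+ 2 / x ^+ 2 * E r -
      - (v r + V r * (2 * g / x + c / x ^+ 2 + E r)) =
    p r ^+ 2 * (2 * (g - be) / x) + eta r ^+ 2 *
     (2 * g / x + (2 * be / x + 2 * al + c / x ^+ 2)) + c / x ^+ 2 * p r ^+ 2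
     + E r * ((p r - b / x) ^+ 2 + (eta r - b / x) ^+ 2).
    rewrite /V /v /be /eta /rho /al -/x; field.
    by rewrite ?oppr_eq0 ?xn ?an.
  have x0 : 0 <= x by lra.
  have sq : 2 * be / x + 2 * al + c / x ^+ 2 = (be / x + 2 * al) ^+ 2 / (2 * al).
    by rewrite /c; field; rewrite ?xn ?aln.
  have gbe : 0 <= 2 * (g - be) by rewrite mulr_ge0// subr_ge0.
  have ge0 : 0 <= 2 * g by rewrite mulr_ge0// ltW.
  have al2' : 0 <= 2 * al by rewrite mulr_ge0// ltW.
  apply: addr_ge0; last by rewrite mulr_ge0// addr_ge0 ?sqr_ge0.
  apply: addr_ge0; last by rewrite mulr_ge0 ?sqr_ge0// divr_ge0 ?sqr_ge0.
  apply: addr_ge0; first by rewrite mulr_ge0 ?sqr_ge0// divr_ge0.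
  by rewrite mulr_ge0 ?sqr_ge0// sq addr_ge0// divr_ge0 ?sqr_ge0.
have -> : - (V r * M r + m r * v r) =
    m r * - (v r + V r * (2 * g / x + c / x ^+ 2 + E r)).
  by rewrite /M -/x; ring.
apply: le_trans (ler_wpM2l m0 key) _.
have x0 : 0 < x by lra.
have mle : m r <= x `^ (2 * g) * expR al^-1.
  rewrite /m -/x; have e1 : expR (- (c / x)) <= 1.
    by rewrite -expR0 ler_expR oppr_le0 divr_ge0// ltW.
  rewrite -mulrA ler_wpM2l ?powR_ge0// -[leRHS]mul1r ler_pM ?expR_ge0//.
  rewrite ler_expR -[leRHS]mul1r ler_wpM2r ?invr_ge0 ?(ltW al0)// E1//; lra.
have step1 : m r * (2 * b ^+ 2 / x ^+ 2 * E r) <=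
    x `^ (2 * g) * expR al^-1 * (2 * b ^+ 2 / x ^+ 2 * E r).
  by rewrite ler_wpM2r// mulr_ge0// divr_ge0 ?exprn_ge0 ?(ltW x0)// mulr_ge0 ?sqr_ge0.
apply: le_trans step1 _.
have -> : x `^ (2 * g) * expR al^-1 * (2 * b ^+ 2 / x ^+ 2 * E r) =
    2 * b ^+ 2 * expR al^-1 * (x `^ (2 * g) / x ^+ 2 * E r).
  by field; rewrite gt_eqF.
have -> : D * W * expR (a / 2 * (t - r)) =
    2 * b ^+ 2 * expR al^-1 * (W * (C * expR (a / 2 * (t - r)))).
  by rewrite /D; ring.
apply: ler_wpM2l.
  by rewrite mulr_ge0 ?expR_ge0// mulr_ge0 ?sqr_ge0.
have r0t : 0 <= r <= t by rewrite (ltW rt) (le_trans s0 (ltW sr)).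
exact: (forcing_weight_bound a0 g0 r0t).
Qed.

(** Some exponent strictly between [1/2] and [1] dominates the growth rate
    [b / |a|]: below [1] the bound vanishes as [t] grows, above [1/2] its
    square is integrable in [s]. *)
Lemma adjoint_decay a b : a < 0 -> a + b < 0 ->
  exists g K, [/\ 1 / 2 < g, g < 1, 0 <= K & forall t p q, 0 <= t ->
    adjoint_pair a b t p q -> forall s, 0 <= s <= t ->
    `|q s - expR (a * (t - s))| <= K * ((1 + t) `^ (g - 1) * (1 + s) `^ (- g))].
Proof.
move=> a0 ab0; pose be := b / - a.
have be1 : be < 1 by rewrite /be ltr_pdivrMr; lra.
have [g [g1 g2 gb]] : exists g, [/\ 1 / 2 < g, g < 1 & be <= g].
  have [h|h] := leP be (1 / 2).
    by exists (3 / 4); split; lra.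
  by exists ((be + 1) / 2); split; lra.
have g0 : 0 < g by lra.
have [K K0 HK] := adjoint_energy_bound a0 gb g0.
exists g, (Num.sqrt K); split=> // t p q t0 pq s st.
have t1 : 0 < 1 + t by lra.
have s1 : 0 < 1 + s by lra.
rewrite powRB1// powRN.
have -> : Num.sqrt K * ((1 + t) `^ g / (1 + t) / (1 + s) `^ g) =
    `|Num.sqrt K * ((1 + t) `^ g / (1 + t) / (1 + s) `^ g)|.
  rewrite ger0_norm// mulr_ge0 ?sqrtr_ge0// divr_ge0 ?powR_ge0// divr_ge0//.
    exact: powR_ge0.
  exact: ltW.
rewrite -ler_sqr ?nnegrE// !real_normK ?num_real//.
apply: le_trans (HK t p q t0 pq s st) _.
rewrite exprMn sqr_sqrtr// !expr_div_n.
have e x : 0 < x -> (x `^ g) ^+ 2 = x `^ (2 * g).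
  by move=> x0; rewrite -powR_mulrn ?powR_ge0// -powRrM mulrC.
by rewrite !e// -mulrA.
Qed.

End adjoint_decay.

(** * The Tricomi function [U(2, 2, z)] *)

Section tricomi_22.
Context {R : realType}.
Notation mu := (@lebesgue_measure R).
Implicit Types (z y : R).

(** The upper incomplete gamma function [Gamma (-1, z)]: the substitution
    [y = 1/v] turns [\int_z^oo e^{-v}/v^2 dv] into a proper integral with a
    bounded integrand. *)
Definition gamma_m1 z : R := \int[mu]_(y in `]0, z^-1]) expR (- y^-1).

Lemma is_derive_expRNV y : 0 < y ->
  is_derive y 1 (fun u : R => expR (- u^-1)) (expR (- y^-1) * - - (y ^- 2 * 1)).
Proof. by move=> y0; have yn : y != 0 by [rewrite gt_eqF]; derive_rules. Qed.

Lemma integrable_expRNV (u : R) :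
  mu.-integrable `]0, u] (EFin \o (fun y : R => expR (- y^-1))).
Proof.
apply: measurable_bounded_integrable => //.
- by rewrite /= lebesgue_measure_itv/=; case: ifP; rewrite ?ltry// -EFinD ltry.
- apply: measurable_realfun.subspace_continuous_measurable_fun => //.
  apply: derivable_within_continuous => y; rewrite in_itv/= => /andP[y0 _].
  by have /@ex_derive := is_derive_expRNV y0.
- exists 1; split=> // M M1 y /=; rewrite in_itv/= => /andP[y0 _].
  rewrite ger0_norm ?expR_ge0// (le_trans _ (ltW M1))// -expR0 ler_expR.
  by rewrite oppr_le0 invr_ge0 ltW.
Qed.

Lemma gamma_m1_bounds z : 0 < z -> 0 <= gamma_m1 z <= z^-1.
Proof.
move=> z0; have iz0 : 0 < z^-1 by rewrite invr_gt0.
apply/andP; split; first by apply: Rintegral_ge0 => y _; exact: expR_ge0.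
have -> : z^-1 = \int[mu]_(y in `]0, z^-1]) 1.
  rewrite Rintegral_cst//= lebesgue_measure_itv/= lte_fin iz0 -EFinD/= subr0.
  by rewrite mul1r.
apply: le_Rintegral => //; first exact: integrable_expRNV.
  have : mu.-integrable `[0, z^-1] (EFin \o (fun=> 1 : R)).
    apply: (continuous_compact_integrable (@segment_compact _ _ _)) => x.
    exact: cvg_cst.
  by apply: integrableS => //; apply: subset_itvr; rewrite bnd_simp.
move=> y; rewrite /= in_itv/= => /andP[y0 _].
by rewrite -expR0 ler_expR oppr_le0 invr_ge0 ltW.
Qed.

Lemma is_derive_gamma_m1 z : 0 < z ->
  is_derive z 1 gamma_m1 (- (expR (- z) / z ^+ 2)).
Proof.
move=> z0; have zn : z != 0 by rewrite gt_eqF.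
have iz0 : 0 < z^-1 by rewrite invr_gt0.
have [||||df dfE] := @continuous_FTC1 R (fun y => expR (- y^-1))
  (BRight 0) z^-1 (z^-1 + 1).
- by rewrite ltrDl.
- exact: integrable_expRNV.
- exact: iz0.
- have /@ex_derive := is_derive_expRNV iz0.
  by move=> /derivable1_diffP /differentiable_continuous.
have dK : is_derive z^-1 1
    (fun u : R => \int[mu]_(y in `]0, u]) expR (- y^-1))%R (expR (- z)).
  move: dfE; rewrite invrK => <-; rewrite derive1E; exact: derivableP.
have dV : is_derive z 1 (fun y : R => y^-1) (- (z ^- 2 * 1)) by derive_rules.
apply: is_derive_eq; first exact: (@is_derive1_comp _ _ _ z _ _ dK dV).
by rewrite mulr1 mulrN.
Qed.

(** Compares two functions that vanish at infinity through their derivatives;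
    the explicit rate provides the point at which a negative value would be
    contradicted. *)
Lemma decreasing_ge0 (f df : R -> R) z : 0 < z ->
  (forall w, z <= w -> is_derive w 1 f (df w)) ->
  (forall w, z <= w -> df w <= 0) ->
  (forall w, z <= w -> 1 <= w -> - w^-1 <= f w) -> 0 <= f z.
Proof.
move=> z0 fd fd0 fw; rewrite leNgt; apply/negP => fz0.
pose w := Num.max z 1 + (- f z)^-1 *+ 2.
have fz : 0 < (- f z)^-1 by rewrite invr_gt0 oppr_gt0.
have mz : z <= Num.max z 1 by rewrite le_max lexx.
have m1 : 1 <= Num.max z 1 by rewrite le_max lexx orbT.
have zw : z <= w by rewrite /w; lra.
have w1 : 1 <= w by rewrite /w; lra.
have fzw : f w <= f z.
  have := @increment_le R f (fun=> 0) df (fun=> 0) z w zw.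
  rewrite subrr subr_le0; apply.
  - by apply: (is_derive_within_continuous (df := df)) => s /andP[zs _]; exact: fd.
  - by move=> x; exact: cvg_cst.
  - by move=> x /andP[zx _]; apply: fd; exact: ltW.
  - by move=> x /andP[zx _]; apply: fd0; exact: ltW.
have u0 : 0 < - f z by rewrite oppr_gt0.
have w0 : 0 < w by lra.
have : - f z <= 1 / w by rewrite div1r; have := fw w zw w1; lra.
rewrite ler_pdivlMr//.
have -> : - f z * w = - f z * Num.max z 1 + 2.
  by rewrite /w; field; rewrite lt_eqF.
have : 0 <= - f z * Num.max z 1 by rewrite mulr_ge0 ?ltW// (lt_le_trans z0).
lra.
Qed.

(** This bound and the next one are the first two partial sums of the asymptotic
    expansion of [Gamma (-1, z)], obtained by integrating by parts. *)
Lemma gamma_m1_upper z : 0 < z -> gamma_m1 z <= expR (- z) / z ^+ 2.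
Proof.
move=> z0; rewrite -subr_ge0.
pose f w := expR (- w) / w ^+ 2 - gamma_m1 w.
apply: (@decreasing_ge0 f (fun w => - (2 * expR (- w) / w ^+ 3)) z z0) => w zw.
- have w0 : 0 < w by lra.
  have wn : w ^+ 2 != 0 by rewrite gt_eqF// exprn_gt0.
  have dG := is_derive_gamma_m1 w0.
  eapply is_derive_eq; first by rewrite /f; derive_rules.
  by rewrite /=; field; rewrite gt_eqF.
- have w0 : 0 < w by lra.
  by rewrite oppr_le0 divr_ge0 ?exprn_ge0 ?(ltW w0)// mulr_ge0 ?expR_ge0.
- move=> w1; have w0 : 0 < w by lra.
  have /andP[_ h] := gamma_m1_bounds w0.
  have : 0 <= expR (- w) / w ^+ 2 by rewrite divr_ge0 ?expR_ge0 ?sqr_ge0.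
  rewrite /f; lra.
Qed.

Lemma gamma_m1_lower z : 0 < z ->
  expR (- z) * (z ^- 2 - 2 * z ^- 3) <= gamma_m1 z.
Proof.
move=> z0; rewrite -subr_ge0.
pose f w := gamma_m1 w - expR (- w) * ((w ^+ 2)^-1 - 2 * (w ^+ 3)^-1).
apply: (@decreasing_ge0 f (fun w => - (6 * expR (- w) / w ^+ 4)) z z0) => w zw.
- have w0 : 0 < w by lra.
  have wn2 : w ^+ 2 != 0 by rewrite gt_eqF// exprn_gt0.
  have wn3 : w ^+ 3 != 0 by rewrite gt_eqF// exprn_gt0.
  have dG := is_derive_gamma_m1 w0.
  eapply is_derive_eq; first by rewrite /f; derive_rules.
  by rewrite /=; field; rewrite gt_eqF.
- have w0 : 0 < w by lra.
  by rewrite oppr_le0 divr_ge0 ?exprn_ge0 ?(ltW w0)// mulr_ge0 ?expR_ge0.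
- move=> w1; have w0 : 0 < w by lra.
  have /andP[h _] := gamma_m1_bounds w0.
  have e1 : expR (- w) <= 1 by rewrite -expR0 ler_expR oppr_le0 ltW.
  have i2 : (w ^+ 2)^-1 <= w^-1.
    by rewrite lef_pV2 ?posrE ?exprn_gt0// expr2 ler_peMl// ltW.
  have i3 : 0 <= (w ^+ 3)^-1 by rewrite invr_ge0 exprn_ge0// ltW.
  have i20 : 0 <= (w ^+ 2)^-1 by rewrite invr_ge0 exprn_ge0// ltW.
  have : expR (- w) * ((w ^+ 2)^-1 - 2 * (w ^+ 3)^-1) <= (w ^+ 2)^-1.
    apply: (@le_trans _ _ (expR (- w) * (w ^+ 2)^-1)).
      by rewrite ler_wpM2l ?expR_ge0//; lra.
    by rewrite ler_piMl.
  rewrite /f; lra.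
Qed.

Lemma sqr_exp_gamma_m1_cvg :
  z ^+ 2 * (expR z * gamma_m1 z) @[z --> +oo] --> (1 : R).
Proof.
have vz : z^-1 @[z --> +oo] --> (0 : R).
  apply/cvgrVy.
    by near=> z; rewrite invr_gt0; near: z; exact: nbhs_pinfty_gt.
  rewrite [X in X @ _](_ : _ = (fun z : R => z)); first exact: cvg_id.
  by apply/funext => z; rewrite /= invrK.
apply: (squeeze_cvgr (f := fun z => 1 - 2 * z^-1) (h := fun=> 1)).
- near=> z; have z0 : 0 < z by near: z; exact: nbhs_pinfty_gt.
  have ez := expR_gt0 z.
  have E : z ^+ 2 * (expR z * (expR (- z) * (z ^- 2 - 2 * z ^- 3))) = 1 - 2 * z^-1.
    by rewrite expRN; field; rewrite !gt_eqF.
  have E2 : z ^+ 2 * (expR z * (expR (- z) / z ^+ 2)) = 1.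
    by rewrite expRN; field; rewrite !gt_eqF.
  apply/andP; split.
    rewrite -E ler_wpM2l ?sqr_ge0// ler_wpM2l ?expR_ge0//; exact: gamma_m1_lower.
  rewrite -[leRHS]E2 ler_wpM2l ?sqr_ge0// ler_wpM2l ?expR_ge0//.
  exact: gamma_m1_upper.
- rewrite -[X in _ --> X]subr0 -[X in _ --> _ - X](mulr0 2).
  by apply: cvgB; [exact: cvg_cst|apply: cvgMr].
- exact: cvg_cst.
Unshelve. all: by end_near. Qed.

Lemma is_derive_exp_gamma_m1 z : 0 < z ->
  is_derive z 1 (fun y => expR y * gamma_m1 y) (expR z * gamma_m1 z - z ^- 2).
Proof.
move=> z0; have dG := is_derive_gamma_m1 z0.
eapply is_derive_eq; first by derive_rules.
by rewrite expRN /=; field; rewrite !gt_eqF ?expR_gt0.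
Qed.

Lemma near_gt0 z : 0 < z -> \forall y \near z, 0 < y.
Proof.
by move=> z0; apply: (@open_nbhs_nbhs _ z [set y | 0 < y]); split => //;
  exact: open_gt.
Qed.

Lemma exp_gamma_m1_is_tricomi :
  is_tricomi 2 2 (fun z : R => expR z * gamma_m1 z).
Proof.
pose w (z : R) := expR z * gamma_m1 z.
have dw z : 0 < z -> is_derive z 1 w (w z - (z ^+ 2)^-1).
  exact: is_derive_exp_gamma_m1.
have w1E z : 0 < z -> derive1 w z = w z - (z ^+ 2)^-1.
  by move=> z0; rewrite derive1E; have [_ ->] := dw z z0.
have dw1 z : 0 < z -> is_derive z 1 (derive1 w) (w z - (z ^+ 2)^-1 + 2 * (z ^+ 3)^-1).
  move=> z0; apply: (@near_eq_is_derive _ _ _ (fun y => w y - (y ^+ 2)^-1)).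
    near=> y; rewrite w1E//; near: y; exact: near_gt0.
  have z2 : z ^+ 2 != 0 by rewrite gt_eqF// exprn_gt0.
  have := dw z z0 => dwz.
  eapply is_derive_eq; first by derive_rules.
  by rewrite /=; field; rewrite gt_eqF.
split=> [z z0|].
  split; first by have /@ex_derive := dw z z0.
    by have /@ex_derive := dw1 z z0.
  rewrite derive1E; have [_ ->] := dw1 z z0; rewrite w1E//.
  by rewrite -/(w z); field; rewrite gt_eqF.
have := sqr_exp_gamma_m1_cvg; apply: cvg_trans; apply: near_eq_cvg.
by near=> z; rewrite powR_mulrn//; near: z; exact: nbhs_pinfty_ge.
Unshelve. all: by end_near. Qed.

Lemma is_derive0_const (f : R -> R) : (forall z, 0 < z -> is_derive z 1 f 0) ->
  forall y z, 0 < y -> 0 < z -> f y = f z.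
Proof.
move=> fd y z; wlog yz : y z / y <= z.
  by move=> h y0 z0; have [/h|/ltW/h] := leP y z; [exact|move->].
move=> y0 z0; apply/esym/eqP; rewrite -subr_eq0 -normr_le0.
have -> : 0 = (fun=> 0 : R) z - (fun=> 0 : R) y by rewrite subrr.
apply: (@abs_increment_le R f (fun=> 0) (fun=> 0) (fun=> 0)) => //.
- apply: (is_derive_within_continuous (df := fun=> 0)) => s /andP[ys _].
  by apply: fd; exact: lt_le_trans ys.
- by move=> x; exact: cvg_cst.
- by move=> x /andP[yx _]; apply: fd; exact: lt_trans yx.
- by rewrite normr0.
Qed.

(** [e^z] is a second solution of Kummer's equation with both parameters equal
    to [2], so the equation integrates twice explicitly: [z^2 (w' - w)] is
    constant, whence [w = e^z (A - k \int_z^oo e^{-v}/v^2 dv)], and the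
    normalisation at infinity forces [A = 0] and [k = -1]. *)
Lemma is_tricomi_22_unique (w : R -> R) : is_tricomi 2 2 w ->
  forall z, 0 < z -> w z = expR z * gamma_m1 z.
Proof.
move=> [ode wlim].
have dw z : 0 < z -> is_derive z 1 w (derive1 w z).
  by move=> z0; rewrite derive1E; apply: derivableP; case: (ode z z0).
have dw1 z : 0 < z -> is_derive z 1 (derive1 w) (derive1 (derive1 w) z).
  by move=> z0; rewrite derive1E; apply: derivableP; case: (ode z z0).
pose k := derive1 w 1 - w 1.
have kE z : 0 < z -> z ^+ 2 * (derive1 w z - w z) = k.
  move=> z0.
  have -> : k = 1 ^+ 2 * (derive1 w 1 - w 1) by rewrite expr1n mul1r.
  apply: (@is_derive0_const (fun z => z ^+ 2 * (derive1 w z - w z))) => // y y0.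
  have := dw y y0; have := dw1 y y0 => dw1y dwy.
  eapply is_derive_eq; first by derive_rules.
  have [_ _ E] := ode y y0; rewrite /=.
  transitivity (y * (y * derive1 (derive1 w) y + (2 - y) * derive1 w y - 2 * w y)).
    by ring.
  by rewrite E mulr0.
pose A := expR (- 1) * w 1 + k * gamma_m1 1.
have AE z : 0 < z -> w z = expR z * (A - k * gamma_m1 z).
  move=> z0; suff : expR (- z) * w z + k * gamma_m1 z = A.
    move=> <-; rewrite expRN; field; rewrite gt_eqF//; exact: expR_gt0.
  apply: (@is_derive0_const (fun z => expR (- z) * w z + k * gamma_m1 z)) => //.
  move=> y y0.
  have := dw y y0; have := is_derive_gamma_m1 y0 => dG dwy.
  eapply is_derive_eq; first by derive_rules.
  by rewrite -(kE y y0) /=; field; rewrite gt_eqF.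
have lim2 : z ^+ 2 * expR z * A @[z --> +oo] --> 1 + k * 1.
  have h : z ^+ 2 * w z @[z --> +oo] --> (1 : R).
    move: wlim; apply: cvg_trans; apply: near_eq_cvg.
    by near=> z; rewrite powR_mulrn//; near: z; exact: nbhs_pinfty_ge.
  apply: (@cvg_trans _ ((fun z : R => z ^+ 2 * w z +
      k * (z ^+ 2 * (expR z * gamma_m1 z))) @ +oo)).
    apply: near_eq_cvg; near=> z.
    by rewrite AE; [ring|near: z; exact: nbhs_pinfty_gt].
  by apply: cvgD => //; apply: cvgMr; exact: sqr_exp_gamma_m1_cvg.
have A0 : A = 0.
  apply/eqP/negPn/negP => An0.
  move/cvgrPdist_lt/(_ 1 ltr01) : lim2 => H.
  have : \forall z \near +oo, z < (`|1 + k * 1| + 1) / `|A|.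
    near=> z; have z1 : 1 <= z by near: z; exact: nbhs_pinfty_ge.
    rewrite ltr_pdivlMr ?normr_gt0//.
    have d : `|1 + k * 1 - z ^+ 2 * expR z * A| < 1 by near: z.
    have : `|z ^+ 2 * expR z * A| < `|1 + k * 1| + 1.
      have := ler_distD (1 + k * 1) 0 (z ^+ 2 * expR z * A).
      rewrite !sub0r !normrN; lra.
    apply: le_lt_trans; rewrite normrM ler_wpM2r// ger0_norm; last first.
      by rewrite mulr_ge0 ?sqr_ge0 ?expR_ge0.
    rewrite expr2 -mulrA ler_peMr ?(le_trans ler01 z1)//.
    by rewrite mulr_ege1// -expR0 ler_expR (le_trans ler01 z1).
  move=> H2.
  have H3 := nbhs_pinfty_ge (num_real ((`|1 + k * 1| + 1) / `|A|)).
  have [z [/= h1 h2]] := filter_ex (filterI H2 H3).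
  by move: h1; rewrite ltNge h2.
have k1 : 1 + k * 1 = 0.
  have := lim2; rewrite A0.
  under eq_fun do rewrite mulr0.
  move=> h; rewrite -(cvg_lim (@Rhausdorff R) h).
  by rewrite (cvg_lim (@Rhausdorff R) (@cvg_cst _ (0 : R) _ _ _)).
move=> z z0; rewrite AE// A0.
have -> : k = -1 by lra.
by rewrite sub0r mulNr opprK mul1r.
Unshelve. all: by end_near. Qed.

Lemma tricomiU_22 z : 0 < z -> tricomiU 2 2 z = expR z * gamma_m1 z.
Proof.
apply: is_tricomi_22_unique; apply: xgetPex.
by exists (fun z : R => expR z * gamma_m1 z); exact: exp_gamma_m1_is_tricomi.
Qed.

End tricomi_22.

(** * Integrals of products of perturbed exponential kernels *)

Section kernel_asymptotics.
Context {R : realType}.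
Implicit Types (a t s g K L Delta : R) (q kap : R -> R).

Lemma product_perturbation (E E1 k d d1 D : R) : 0 <= k -> 0 <= E1 -> E1 <= E ->
  `|d| <= D -> `|d1| <= D ->
  `|(E + k + d) * (E1 + k + d1) - (E * E1 + k * k)| <=
    2 * (k * E) + 2 * (D * E) + 2 * (D * k) + D * D.
Proof.
move=> k0 E10 E1E dD d1D.
have E0 : 0 <= E by exact: le_trans E1E.
have D0 : 0 <= D by exact: le_trans (normr_ge0 _) dD.
have -> : (E + k + d) * (E1 + k + d1) - (E * E1 + k * k) =
  k * E + k * E1 + d * E1 + d * k + d1 * E + d1 * k + d * d1 by ring.
have h1 : `|k * E| <= k * E by rewrite ger0_norm// mulr_ge0.
have h2 : `|k * E1| <= k * E by rewrite ger0_norm ?mulr_ge0// ler_wpM2l.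
have h3 : `|d * E1| <= D * E by rewrite normrM ler_pM// ger0_norm.
have h4 : `|d * k| <= D * k by rewrite normrM ler_pM// ger0_norm.
have h5 : `|d1 * E| <= D * E by rewrite normrM ler_pM// ger0_norm.
have h6 : `|d1 * k| <= D * k by rewrite normrM ler_pM// ger0_norm.
have h7 : `|d * d1| <= D * D by rewrite normrM ler_pM.
move: (k * E) (k * E1) (d * E1) (d * k) (d1 * E) (d1 * k) (d * d1)
  h1 h2 h3 h4 h5 h6 h7 => x1 x2 x3 x4 x5 x6 x7.
have := ler_normD (x1 + x2 + x3 + x4 + x5 + x6) x7.
have := ler_normD (x1 + x2 + x3 + x4 + x5) x6.
have := ler_normD (x1 + x2 + x3 + x4) x5.
have := ler_normD (x1 + x2 + x3) x4.
have := ler_normD (x1 + x2) x3; have := ler_normD x1 x2.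
lra.
Qed.

(** For [1/2 < g < 1] the first factor vanishes as [t] grows, and the square of
    the second is integrable in [s]. *)
Definition kernel_rate g t s : R := (1 + t) `^ (g - 1) * (1 + s) `^ (- g).

Definition kernel_near a t (kap : R -> R) g K q :=
  forall s, 0 <= s <= t ->
    `|q s - expR (a * (t - s)) - kap s| <= K * kernel_rate g t s.

(** Pointwise, all cross terms carry the vanishing factor [(1 + t)^{g-1}]
    times a function of [s] with bounded integral over [0, t]. *)
Lemma kernel_product_bound a t Delta g K L q q1 kap : a < 0 -> 0 <= t ->
  0 <= Delta -> 1 / 2 < g -> g < 1 -> 0 <= K -> 0 <= L ->
  (forall s, 0 <= s -> 0 <= kap s <= L / (1 + s)) ->
  kernel_near a t kap g K q -> kernel_near a (t + Delta) kap g K q1 ->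
  forall s, 0 <= s <= t ->
  `|q s * q1 s - (expR (a * (t - s)) * expR (a * (t + Delta - s)) +
      kap s * kap s)| <=
  (1 + t) `^ (g - 1) *
    ((2 * L * (1 + (- a / 2)^-1) + 2 * K) * expR (a / 2 * (t - s)) +
     (2 * K * L + K ^+ 2) * (1 + s) `^ (- (2 * g))).
Proof.
move=> a0 t0 D0 g1 g2 K0 L0 Hk Hq Hq1 s /andP[s0 st].
have st' : 0 <= s <= t by rewrite s0.
have st1 : 0 <= s <= t + Delta by rewrite s0; lra.
have /andP[k0 kL] := Hk s s0.
set E := expR (a * (t - s)); set E1 := expR (a * (t + Delta - s)).
have E0 : 0 <= E by exact: expR_ge0.
have E10 : 0 <= E1 by exact: expR_ge0.
have E1E : E1 <= E by rewrite ler_expR; nra.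
set X := (1 + t) `^ (g - 1); set Y := (1 + s) `^ (- g).
have X0 : 0 <= X by exact: powR_ge0.
have Y0 : 0 <= Y by exact: powR_ge0.
have t1 : 1 <= 1 + t by lra.
have s1 : 1 <= 1 + s by lra.
have X1 : X <= 1 by rewrite -(powRr0 (1 + t)) ler_powR//; lra.
have Y1 : Y <= 1 by rewrite -(powRr0 (1 + s)) ler_powR//; lra.
have d0 : `|q s - E - kap s| <= K * (X * Y) by exact: Hq.
have d1 : `|q1 s - E1 - kap s| <= K * (X * Y).
  apply: le_trans (Hq1 s st1) _; rewrite ler_wpM2l// ler_wpM2r//.
  rewrite /X -[g - 1]opprB !powRN lef_pV2 ?posrE ?powR_gt0//; [|lra|lra].
  by apply: ge0_ler_powR; rewrite ?nnegrE; lra.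
have := product_perturbation k0 E10 E1E d0 d1.
have -> : (E + kap s + (q s - E - kap s)) *
  (E1 + kap s + (q1 s - E1 - kap s)) = q s * q1 s by ring.
move/le_trans; apply.
have F0 : 0 <= expR (a / 2 * (t - s)) by exact: expR_ge0.
set F := expR (a / 2 * (t - s)) in F0 *.
have EF : E <= F by rewrite ler_expR; nra.
have c1 : kap s * E <= L * (1 + (- a / 2)^-1) * (X * F).
  have : kap s * E <= L / (1 + s) * E by rewrite ler_wpM2r.
  move/le_trans; apply; rewrite -!mulrA ler_wpM2l//.
  have al2 : 0 < - a / 2 by lra.
  have ts0 : 0 <= t - s by lra.
  have h := linear_le_expR al2 ts0.
  have h1 : (1 + s)^-1 <= (1 + t)^-1 * (1 + (t - s)).
    rewrite mulrC ler_pdivlMr; last lra.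
    rewrite mulrC ler_pdivrMr; last lra.
    rewrite -subr_ge0.
    have -> : (1 + (t - s)) * (1 + s) - (1 + t) = (t - s) * s by ring.
    by rewrite mulr_ge0.
  have h2 : (1 + t)^-1 <= X.
    by rewrite -(powR_inv1 (le_trans ler01 t1)) ler_powR//; lra.
  have h3 : (1 + s)^-1 <= X * ((1 + (- a / 2)^-1) * expR (- a / 2 * (t - s))).
    apply: le_trans h1 _; rewrite ler_pM//; first by rewrite invr_ge0; lra.
    lra.
  apply: le_trans (ler_wpM2r E0 h3) _.
  have -> : E = F * F by rewrite /E /F -expRD; congr expR; field.
  have -> : expR (- a / 2 * (t - s)) = F^-1.
    by rewrite /F -expRN; congr expR; field.
  have an : a != 0 by rewrite lt_eqF.
  have Fn : F != 0 by rewrite gt_eqF ?expR_gt0.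
  by rewrite le_eqVlt; apply/orP; left; apply/eqP; field; rewrite ?an ?Fn.
have c2 : K * (X * Y) * E <= K * (X * F).
  rewrite -!mulrA ler_wpM2l// ler_wpM2l// -[F]mul1r ler_pM//.
have YY : Y * Y = (1 + s) `^ (- (2 * g)).
  have sn : 1 + s != 0 by rewrite gt_eqF//; lra.
  rewrite /Y -powRD; last by rewrite sn implybT.
  by congr (_ `^ _); ring.
have c3 : K * (X * Y) * kap s <= K * L * (X * (Y * Y)).
  have yY : (1 + s)^-1 <= Y.
    by rewrite -(powR_inv1 (le_trans ler01 s1)) ler_powR//; lra.
  have : K * (X * Y) * kap s <= K * (X * Y) * (L * Y).
    by rewrite ler_wpM2l ?mulr_ge0// (le_trans kL)// ler_wpM2l.
  by move/le_trans; apply; rewrite le_eqVlt; apply/orP; left; apply/eqP; ring.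
have c4 : K * (X * Y) * (K * (X * Y)) <= K ^+ 2 * (X * (Y * Y)).
  have -> : K * (X * Y) * (K * (X * Y)) = K ^+ 2 * (Y * Y) * (X * X) by ring.
  have -> : K ^+ 2 * (X * (Y * Y)) = K ^+ 2 * (Y * Y) * X by ring.
  by rewrite ler_wpM2l ?mulr_ge0 ?sqr_ge0// ler_piMl.
rewrite -YY.
have -> : X * ((2 * L * (1 + (- a / 2)^-1) + 2 * K) * F +
    (2 * K * L + K ^+ 2) * (Y * Y)) =
  2 * (L * (1 + (- a / 2)^-1) * (X * F)) + 2 * (K * (X * F)) +
  2 * (K * L * (X * (Y * Y))) + K ^+ 2 * (X * (Y * Y)) by ring.
by move: c1 c2 c3 c4; lra.
Qed.

(** [Phi] and [Psi] stand for the integrals of [q q1] and [kap ^ 2], and the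
    explicit term is the integral of the product of the two exponentials; [H]
    below is an antiderivative of the pointwise bound. *)
Lemma kernel_increment_bound a Delta g K L kap : a < 0 ->
  0 <= Delta -> 1 / 2 < g -> g < 1 -> 0 <= K -> 0 <= L ->
  (forall s, 0 <= s -> 0 <= kap s <= L / (1 + s)) ->
  exists C, forall t q q1 (Phi Psi : R -> R), 0 <= t ->
    kernel_near a t kap g K q -> kernel_near a (t + Delta) kap g K q1 ->
    {within `[0, t], continuous Phi} -> {within `[0, t], continuous Psi} ->
    (forall s, 0 < s < t -> is_derive s 1 Phi (q s * q1 s)) ->
    (forall s, 0 < s < t -> is_derive s 1 Psi (kap s * kap s)) ->
    `|Phi t - Phi 0 - (Psi t - Psi 0) -
      expR (a * Delta) / (2 * - a) * (1 - expR (2 * a * t))| <=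
    C * (1 + t) `^ (g - 1).
Proof.
move=> a0 D0 g1 g2 K0 L0 Hk.
pose A := 2 * L * (1 + (- a / 2)^-1) + 2 * K; pose B := 2 * K * L + K ^+ 2.
have an : a != 0 by rewrite lt_eqF.
have A0 : 0 <= A.
  by rewrite addr_ge0 ?mulr_ge0// addr_ge0// invr_ge0; lra.
have B0 : 0 <= B by rewrite addr_ge0 ?sqr_ge0// !mulr_ge0.
have gn : 1 - 2 * g != 0 by rewrite lt_eqF//; lra.
exists (A * (2 / - a) + B / (2 * g - 1)).
move=> t q q1 Phi Psi t0 Hq Hq1 cPhi cPsi dPhi dPsi.
pose N s := expR (a * (2 * t + Delta - 2 * s)) / (2 * - a).
pose G s := Phi s - Psi s - N s.
pose H s := (1 + t) `^ (g - 1) * (A * (2 / - a * expR (a / 2 * (t - s))) +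
  B * ((1 + s) `^ (1 - 2 * g) / (1 - 2 * g))).
have dN s : is_derive s 1 N (expR (a * (t - s)) * expR (a * (t + Delta - s))).
  eapply is_derive_eq; first by rewrite /N; derive_rules.
  rewrite /= -expRD (_ : a * (t - s) + _ = a * (2 * t + Delta - 2 * s)); last by ring.
  by field.
have dH s : 0 <= s -> is_derive s 1 H ((1 + t) `^ (g - 1) *
    (A * expR (a / 2 * (t - s)) + B * (1 + s) `^ (- (2 * g)))).
  move=> s0; have s1 : 0 < 1 + s by lra.
  eapply is_derive_eq; first by rewrite /H; derive_rules.
  rewrite /= (_ : 1 - 2 * g - 1 = - (2 * g)); last by ring.
  by field; rewrite an gn.
have cN : {within `[0, t], continuous N} :=
  @is_derive_within_continuous R 0 t N _ (fun s _ => dN s).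
have cH : {within `[0, t], continuous H} :=
  @is_derive_within_continuous R 0 t H _
    (fun s st => dH s (proj1 (andP st))).
have -> : Phi t - Phi 0 - (Psi t - Psi 0) -
    expR (a * Delta) / (2 * - a) * (1 - expR (2 * a * t)) = G t - G 0.
  rewrite /G /N (_ : a * (2 * t + Delta - 2 * t) = a * Delta); last by ring.
  rewrite (_ : a * (2 * t + Delta - 2 * 0) = a * Delta + 2 * a * t); last by ring.
  by rewrite expRD; ring.
have GH : `|G t - G 0| <= H t - H 0.
  apply: (@abs_increment_le R G H
    (fun s => q s * q1 s - kap s * kap s -
       expR (a * (t - s)) * expR (a * (t + Delta - s)))
    (fun s => (1 + t) `^ (g - 1) *
    (A * expR (a / 2 * (t - s)) + B * (1 + s) `^ (- (2 * g))))).
  - exact: t0.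
  - move=> s; apply: cvgB; first by apply: cvgB; [exact: cPhi|exact: cPsi].
    exact: cN.
  - exact: cH.
  - move=> s sx.
    exact: (is_derive_funB (is_derive_funB (dPhi s sx) (dPsi s sx)) (dN s)).
  - by move=> s /andP[s0 _]; apply: dH; exact: ltW.
  - move=> s /andP[s0 st]; have st' : 0 <= s <= t by rewrite !ltW.
    have := kernel_product_bound a0 t0 D0 g1 g2 K0 L0 Hk Hq Hq1 st'.
    by congr (`|_| <= _); ring.
apply: le_trans GH _; rewrite /H -mulrBr mulrC ler_wpM2r ?powR_ge0//.
rewrite subrr mulr0 expR0 mulr1 addr0 powR1.
have h1 : 0 <= 2 / - a * expR (a / 2 * (t - 0)).
  by rewrite mulr_ge0 ?expR_ge0// divr_ge0//; lra.
have h2 : (1 + t) `^ (1 - 2 * g) / (1 - 2 * g) <= 0.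
  by rewrite mulr_ge0_le0 ?powR_ge0// invr_le0; lra.
have -> : B / (2 * g - 1) = B * - (1 / (1 - 2 * g)).
  by field; rewrite gn gt_eqF//; lra.
have := mulr_ge0 A0 h1; have := mulr_ge0_le0 B0 h2.
move: (A * (2 / - a)) (B * _) (A * _) => u v w; rewrite -mulrN; lra.
Qed.

Lemma cvg_powR_neg (g : R) : g < 1 -> (1 + t) `^ (g - 1) @[t --> +oo] --> (0 : R).
Proof.
move=> g1; apply/cvgr0Pnorm_lt => e e0; near=> t.
have t0 : 0 < 1 + t.
  by rewrite addr_gt0//; near: t; exact: nbhs_pinfty_gt.
rewrite ger0_norm ?powR_ge0// /powR gt_eqF// -[ltRHS]lnK ?posrE// ltr_expR.
have g1' : g - 1 < 0 by lra.
rewrite mulrC -ltr_ndivrMr//.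
rewrite -ltr_expR [ltRHS]lnK ?posrE// -ltrBlDl.
by near: t; exact: nbhs_pinfty_gt.
Unshelve. all: by end_near. Qed.

Lemma kernel_limit a Delta g C (f : R -> R) : a < 0 -> g < 1 ->
  (forall t, 0 < t ->
    `|f t - expR (a * Delta) / (2 * - a) * (1 - expR (2 * a * t))| <=
    C * (1 + t) `^ (g - 1)) ->
  f t @[t --> +oo] --> expR (a * Delta) / (2 * - a).
Proof.
move=> a0 g1 Hf; set c := expR (a * Delta) / (2 * - a).
have e0 : expR (2 * a * t) @[t --> +oo] --> (0 : R).
  apply: (@cvg_trans _ (expR (- (- 2 * a * t)) @[t --> +oo])).
    by apply: near_eq_cvg; near=> t; congr expR; ring.
  apply: (@cvg_comp _ _ _ (fun t => - 2 * a * t) (fun y => expR (- y)) _ +oo).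
    by apply: gt0_cvgMry; [rewrite nmulr_rgt0; lra|exact: cvg_id].
  exact: cvgr_expR.
have h1 : c * (1 - expR (2 * a * t)) @[t --> +oo] --> c.
  rewrite -[X in _ --> X]mulr1 -[X in _ --> c * X]subr0.
  by apply: cvgMr; apply: cvgB => //; exact: cvg_cst.
have h2 : C * (1 + t) `^ (g - 1) @[t --> +oo] --> (0 : R).
  by rewrite -(mulr0 C); apply: cvgMr; exact: cvg_powR_neg.
have h3 : f t - c * (1 - expR (2 * a * t)) @[t --> +oo] --> (0 : R).
  apply/cvgr0Pnorm_lt => e ep; move/cvgr0Pnorm_lt : h2 => /(_ e ep) h2.
  near=> t; apply: le_lt_trans (Hf t _) _.
    by near: t; exact: nbhs_pinfty_gt.
  by apply: le_lt_trans (ler_norm _) _; near: t.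
rewrite -[X in _ --> X]add0r.
apply: (@cvg_trans _ ((fun t => (f t - c * (1 - expR (2 * a * t))) +
  c * (1 - expR (2 * a * t))) @ +oo)).
  by apply: near_eq_cvg; near=> t; rewrite subrK.
exact: cvgD.
Unshelve. all: by end_near. Qed.

End kernel_asymptotics.

(** * Gaussian moments *)

Section normal_moments.
Context {R : realType}.
Notation mu := (@lebesgue_measure R).
Variable s : R.
Hypothesis s0 : 0 < s.

Let g := normal_pdf 0 s.

Let gE x : g x = normal_peak s * expR (- x ^+ 2 / (s ^+ 2 *+ 2)).
Proof. by rewrite /g normal_pdfE ?gt_eqF// /normal_fun subr0. Qed.

Let g_ge0 x : 0 <= g x. Proof. exact: normal_pdf_ge0. Qed.

Let g_even x : g (- x) = g x. Proof. by rewrite !gE sqrrN. Qed.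

Let cg : continuous g. Proof. by apply: continuous_normal_pdf; rewrite gt_eqF. Qed.

Let mg : measurable_fun setT g. Proof. exact: measurable_normal_pdf. Qed.

Let dg (x : R) : is_derive x 1 g (- x / s ^+ 2 * g x).
Proof.
have sn : s ^+ 2 != 0 by rewrite gt_eqF ?exprn_gt0.
have -> : g = fun y => normal_peak s * expR (- y ^+ 2 * (s ^+ 2 *+ 2)^-1).
  by apply/funext => y; rewrite gE.
eapply is_derive_eq; first by derive_rules.
by rewrite /=; field; rewrite gt_eqF.
Qed.

Lemma ge0_integral_normal_prob (f : R -> R) : (forall x, 0 <= f x) ->
  measurable_fun setT f ->
  (\int[normal_prob 0 s]_x (f x)%:E = \int[mu]_x (f x * g x)%:E)%E.
Proof.
move=> f0 mf.
have dom := @normal_prob_dominates R 0 s.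
have /measurable_EFinP mfE := mf.
have f0E x : (0 <= (EFin \o f) x)%E by rewrite lee_fin.
rewrite -(Radon_Nikodym_SigmaFinite.change_of_variables dom f0E measurableT mfE).
transitivity (\int[mu]_x ((f x)%:E * (g x)%:E))%E; last first.
  by apply: eq_integral => x _; rewrite EFinM.
apply: ae_eq_integral => //.
- apply: emeasurable_funM; first exact/measurable_EFinP.
  exact: (measurable_int mu (Radon_Nikodym_SigmaFinite.f_integrable dom)).
- by apply: emeasurable_funM => //; exact/measurable_EFinP.
- apply: ae_eqe_mul2l; apply: integral_ae_eq => //.
  + exact: Radon_Nikodym_SigmaFinite.f_integrable.
  + exact/measurable_EFinP.
  + move=> E _ mE; rewrite -(Radon_Nikodym_SigmaFinite.f_integral dom)//.
Qed.

Lemma ge0_integral_oppr (f : R -> \bar R) : (forall x, 0 <= f x)%E ->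
  measurable_fun setT f -> (\int[mu]_x f (- x)%R = \int[mu]_x f x)%E.
Proof.
move=> f0 mf.
rewrite -[LHS]/(\int[mu]_(x in (-%R : _ -> measurableTypeR R) @^-1` setT)
  (f \o (-%R : _ -> measurableTypeR R)) x)%E.
rewrite -ge0_integral_pushforward//=.
by apply: eq_measure_integral => //= A mA _; exact: lebesgue_measureN.
Qed.

Let half : (\int[mu]_(x in `[0%R, +oo[) (g x)%:E = (1 / 2)%:E)%E.
Proof.
have := @integral_normal_pdf R 0 s.
rewrite (ge0_symfun_integralT g_ge0 cg (fun x => esym (g_even x))).
rewrite -set_itvcy.
case: (\int[mu]_(x in _) _)%E => [r| |] /=.
- by rewrite -EFinM => -[] h; congr (_%:E); lra.
- by rewrite gt0_muley// lte_fin.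
- by rewrite gt0_muleNy// lte_fin.
Qed.

Let G x := \int[mu]_(y in `[0, x]) g y.

Let cgs (x : R) : {within `[0, x], continuous g}.
Proof. by apply: continuous_subspaceT => y; exact: cg. Qed.

Let dG (x : R) : 0 < x -> is_derive x 1 G (g x).
Proof.
move=> x0; have h : 0 < x < x + 1 by lra.
have c : {within `[0, x + 1], continuous g} by exact: cgs.
exact: (primitive_is_derive c h).
Qed.

Let cG (x : R) : 0 <= x -> {within `[0, x], continuous G}.
Proof. by move=> x0; apply: primitive_continuous. Qed.

Let G_cvg : G n%:R @[n --> \oo] --> (1 / 2 : R).
Proof.
have := @ge0_cvgn_integral R mu g g_ge0 mg.
rewrite half => /fine_cvg; apply: cvg_trans; exact: cvg_id.
Qed.

Let xg_cvg : n%:R * g n%:R @[n --> \oo] --> (0 : R).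
Proof.
have C0 : 0 <= normal_peak s * (s ^+ 2 *+ 2).
  by rewrite mulr_ge0 ?normal_peak_ge0// mulrn_wge0// sqr_ge0.
apply: (squeeze_cvgr (f := fun=> 0)
  (h := fun n => normal_peak s * (s ^+ 2 *+ 2) * n%:R^-1)); last 2 first.
- exact: cvg_cst.
- rewrite -(mulr0 (normal_peak s * (s ^+ 2 *+ 2))); apply: cvgMr.
  by rewrite -cvg_shiftS; exact: cvg_harmonic.
near=> n; have n0 : 0 < n%:R :> R by rewrite ltr0n; near: n; exists 1%N.
rewrite mulr_ge0//= gE.
set y := n%:R ^+ 2 / (s ^+ 2 *+ 2).
have y0 : 0 < y by rewrite divr_gt0 ?exprn_gt0// pmulrn_lgt0 ?exprn_gt0.
have h : expR (- y) <= y^-1.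
  rewrite expRN lef_pV2 ?posrE ?expR_gt0//.
  by have := expR_ge1Dx y; lra.
have -> : - n%:R ^+ 2 / (s ^+ 2 *+ 2) = - y by rewrite /y mulNr.
rewrite mulrCA -[leRHS]mulrA; apply: ler_wpM2l; first exact: normal_peak_ge0.
apply: le_trans (ler_wpM2l (ltW n0) h) _.
rewrite /y le_eqVlt; apply/orP; left; apply/eqP; field.
by rewrite !gt_eqF.
Unshelve. all: by end_near. Qed.

Let half_moment : (\int[mu]_(x in `[0%R, +oo[) (x ^+ 2 * g x)%:E =
  (s ^+ 2 / 2)%:E)%E.
Proof.
have mf : measurable_fun setT (fun x : R => x ^+ 2 * g x).
  by apply: measurable_funM => //; exact: measurable_funX.
have f0 (x : R) : 0 <= x ^+ 2 * g x by rewrite mulr_ge0 ?sqr_ge0.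
have := @ge0_cvgn_integral R mu _ f0 mf.
(* Integration by parts with [x g x = - s^2 g' x]. *)
pose F x := s ^+ 2 * (G x - x * g x).
have FE n : (0 < n)%N ->
    (\int[mu]_(x in `[0%R, n%:R]) (x ^+ 2 * g x)%:E = (F n%:R)%:E)%E.
  move=> n0; have n0' : 0 < n%:R :> R by rewrite ltr0n.
  have dF (x : R) : 0 < x -> is_derive x 1 F (x ^+ 2 * g x).
    move=> x0; have dGx := dG x0; have dgx := dg x.
    eapply is_derive_eq; first by rewrite /F; derive_rules.
    by rewrite /=; field; rewrite gt_eqF.
  have cGn : {within `[0, n%:R], continuous G} by exact: cG (ltW n0').
  have cF : {within `[0, n%:R], continuous F}.
    move=> x; apply: cvgMr; apply: cvgB; first exact: cGn.
    by apply: cvgM; [apply: (@continuous_subspaceT _ _ _ id) => ?; exact: cvg_id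
      |exact: cgs].
  rewrite (@continuous_FTC2 _ _ F)//.
  - have -> : F 0 = 0.
      by rewrite /F mul0r subr0 /G set_itv1 Rintegral_set1 mulr0.
    by rewrite sube0.
  - apply: continuous_subspaceT => x.
    apply: cvgM; last exact: cg.
    by apply: (@continuous_comp _ _ _ id (fun y : R => y ^+ 2));
      [exact: cvg_id|exact: exprn_continuous].
  - have /continuous_within_itvP := cF; move=> /(_ n0')[_ c1 c2].
    split => // x; rewrite in_itv/= => /andP[x0 _].
    by have /@ex_derive := dF x x0.
  - move=> x; rewrite in_itv/= => /andP[x0 _].
    by rewrite derive1E; have [_ ->] := dF x x0.
have Fcvg : (F n%:R)%:E @[n --> \oo] --> (s ^+ 2 / 2)%:E.
  apply: cvg_EFin; first by near=> n.
  have -> : s ^+ 2 / 2 = s ^+ 2 * (1 / 2 - 0) by field.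
  by apply: cvgMr; apply: cvgB; [exact: G_cvg|exact: xg_cvg].
move=> h; apply: (cvg_unique _ h) => //.
apply: cvg_trans Fcvg; apply: near_eq_cvg; near=> n; rewrite /= FE//.
by near: n; exists 1%N.
Unshelve. all: by end_near. Qed.

Lemma normal_prob_second_moment :
  (\int[normal_prob 0 s]_x (x ^+ 2)%:E = (s ^+ 2)%:E)%E.
Proof.
rewrite (@ge0_integral_normal_prob (fun x => x ^+ 2)); last 2 first.
- by move=> x; exact: sqr_ge0.
- exact: measurable_funX.
rewrite ge0_symfun_integralT.
- by rewrite -set_itvcy half_moment -EFinM; congr (_%:E); field.
- by move=> x; rewrite mulr_ge0 ?sqr_ge0.
- move=> x; apply: cvgM; last exact: cg.
  by apply: (@continuous_comp _ _ _ id (fun y : R => y ^+ 2));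
      [exact: cvg_id|exact: exprn_continuous].
- by move=> x; rewrite /= sqrrN g_even.
Qed.

(** The vanishing of the first moment, for integrands of constant sign only. *)
Lemma normal_prob_first_moment_parts :
  (\int[normal_prob 0 s]_x (Num.max x 0)%:E =
   \int[normal_prob 0 s]_x (Num.max (- x) 0)%:E)%E.
Proof.
have mp : measurable_fun setT (fun x : R => Num.max x 0).
  by apply: measurable_maxr => //.
have mn : measurable_fun setT (fun x : R => Num.max (- x) 0).
  by apply: measurable_maxr => //.
rewrite (@ge0_integral_normal_prob (fun x => Num.max x 0))//; last first.
  by move=> x; rewrite le_max lexx orbT.
rewrite (@ge0_integral_normal_prob (fun x => Num.max (- x) 0))//; last first.
  by move=> x; rewrite le_max lexx orbT.
rewrite -[RHS]ge0_integral_oppr.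
- by apply: eq_integral => x _; rewrite opprK g_even.
- by move=> x; rewrite lee_fin mulr_ge0// le_max lexx orbT.
- by apply/measurable_EFinP; exact: measurable_funM.
Qed.

End normal_moments.

(** * Square integrable random variables *)

Section square_integrable.
Context (d : measure_display) (T : measurableType d) (R : realType).
Variable P : probability T R.
Implicit Types (X Y Z U V : T -> R).

Definition square_integrable X :=
  measurable_fun setT X /\ P.-integrable setT (fun w => (X w ^+ 2)%:E).

Lemma square_integrableM X Y : square_integrable X -> square_integrable Y ->
  P.-integrable setT (EFin \o (fun w => X w * Y w)).
Proof.
move=> [mX iX] [mY iY].
have iXY : P.-integrable setT (EFin \o (fun w => X w ^+ 2 + Y w ^+ 2)).
  exact: (integrableD measurableT iX iY).
apply: (le_integrable measurableT _ _ iXY).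
  by apply/measurable_EFinP; exact: measurable_funM.
move=> w _ /=; rewrite lee_fin [leRHS]ger0_norm ?addr_ge0 ?sqr_ge0//.
rewrite ler_norml; apply/andP; split.
  by have := sqr_ge0 (X w + Y w); have := sqr_ge0 (X w); have := sqr_ge0 (Y w); nra.
by have := sqr_ge0 (X w - Y w); have := sqr_ge0 (X w); have := sqr_ge0 (Y w); nra.
Qed.

Lemma square_integrable_cst c : square_integrable (fun=> c).
Proof.
split; first exact: measurable_cst.
exact: (finite_measure_integrable_cst P (c ^+ 2)).
Qed.

Lemma square_integrableZ c X : square_integrable X ->
  square_integrable (fun w => c * X w).
Proof.
move=> [mX iX]; split; first by apply: measurable_funM.
apply: eq_integrable (integrableZl measurableT (c ^+ 2) iX) => // w _.
by rewrite exprMn EFinM.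
Qed.

Lemma square_integrableD X Y : square_integrable X -> square_integrable Y ->
  square_integrable (fun w => X w + Y w).
Proof.
move=> sX sY; have iXY := square_integrableM sX sY.
case: sX => mX iX; case: sY => mY iY; split; first exact: measurable_funD.
have h := integrableD measurableT (integrableD measurableT iX
  (integrableZl measurableT 2 iXY)) iY.
apply: eq_integrable h => // w _ /=.
by rewrite -EFinM -!EFinD; congr (_%:E); ring.
Qed.

Lemma square_integrableB X Y : square_integrable X -> square_integrable Y ->
  square_integrable (fun w => X w - Y w).
Proof.
move=> sX sY; have := square_integrableD sX (square_integrableZ (-1) sY).
by congr square_integrable; apply/funext => w; rewrite mulN1r.
Qed.

Lemma square_integrable_sum (I : Type) (r : seq I) (F : I -> T -> R) :
  (forall i, square_integrable (F i)) ->
  square_integrable (fun w => \sum_(i <- r) F i w).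
Proof.
move=> sF; elim: r => [|i r IH].
  have := square_integrable_cst 0; congr square_integrable.
  by apply/funext => w; rewrite big_nil.
have := square_integrableD (sF i) IH; congr square_integrable.
by apply/funext => w; rewrite big_cons.
Qed.

Lemma square_integrable1 X : square_integrable X ->
  P.-integrable setT (EFin \o X).
Proof.
move=> sX; have := square_integrableM sX (square_integrable_cst 1).
by congr (P.-integrable setT _); apply/funext => w; rewrite /= mulr1.
Qed.

Lemma mean_mulDl X Y Z : square_integrable X -> square_integrable Y ->
  square_integrable Z ->
  \int[P]_w ((X w + Y w) * Z w) = \int[P]_w (X w * Z w) + \int[P]_w (Y w * Z w).
Proof.
move=> sX sY sZ; rewrite -RintegralD//; try exact: square_integrableM.
by apply: eq_Rintegral => w _; rewrite mulrDl.
Qed.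

Lemma mean_mulZl c X Z : square_integrable X -> square_integrable Z ->
  \int[P]_w (c * X w * Z w) = c * \int[P]_w (X w * Z w).
Proof.
move=> sX sZ; rewrite -RintegralZl//; last exact: square_integrableM.
by apply: eq_Rintegral => w _; rewrite mulrA.
Qed.

Lemma mean_mulC X Y : \int[P]_w (X w * Y w) = \int[P]_w (Y w * X w).
Proof. by apply: eq_Rintegral => w _; rewrite mulrC. Qed.

Lemma mean_mul_suml (I : Type) (r : seq I) (F : I -> T -> R) Z :
  (forall i, square_integrable (F i)) -> square_integrable Z ->
  \int[P]_w ((\sum_(i <- r) F i w) * Z w) =
  \sum_(i <- r) \int[P]_w (F i w * Z w).
Proof.
move=> sF sZ; elim: r => [|i r IH].
  rewrite big_nil; under eq_Rintegral do rewrite big_nil mul0r.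
  by rewrite Rintegral_cst// mul0r.
rewrite big_cons -IH -mean_mulDl//; last exact: square_integrable_sum.
by apply: eq_Rintegral => w _; rewrite big_cons.
Qed.

Lemma mean_sqr_ge0 X : 0 <= \int[P]_w (X w * X w).
Proof. by apply: Rintegral_ge0 => w _; rewrite -expr2 sqr_ge0. Qed.

Lemma cauchy_schwarz_mean X Y : square_integrable X -> square_integrable Y ->
  (\int[P]_w (X w * Y w)) ^+ 2 <=
  \int[P]_w (X w * X w) * \int[P]_w (Y w * Y w).
Proof.
move=> sX sY.
set A := \int[P]_w (X w * X w); set C := \int[P]_w (Y w * Y w).
set B := \int[P]_w (X w * Y w).
(* The mean of [(X + l Y)^2]; its minimum in [l] gives the inequality. *)
have q l : 0 <= A + 2 * l * B + l ^+ 2 * C.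
  have sl := square_integrableZ l sY.
  have := mean_sqr_ge0 (fun w => X w + l * Y w).
  rewrite mean_mulDl//; last exact: square_integrableD.
  rewrite (mean_mulC X) (mean_mulC (fun w => l * Y w)) !mean_mulDl//.
  rewrite !mean_mulZl// (mean_mulC Y (fun w => l * Y w)) mean_mulZl//.
  rewrite (mean_mulC X (fun w => l * Y w)) mean_mulZl// (mean_mulC Y X).
  by rewrite -/A -/B -/C => h; apply: le_trans h _; rewrite le_eqVlt;
    apply/orP; left; apply/eqP; ring.
have C0 : 0 <= C by exact: mean_sqr_ge0.
have A0 : 0 <= A by exact: mean_sqr_ge0.
have [C0'|Cn] := eqVneq C 0.
  have [->|Bn] := eqVneq B 0; first by rewrite expr0n/= mulr_ge0.
  have := q (- (A + 1) / (2 * B)); rewrite C0' mulr0 addr0.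
  have -> : A + 2 * (- (A + 1) / (2 * B)) * B = -1 by field.
  lra.
have Cp : 0 < C by rewrite lt0r Cn.
have := q (- B / C).
have -> : A + 2 * (- B / C) * B + (- B / C) ^+ 2 * C = (A * C - B ^+ 2) / C.
  by field.
by rewrite pmulr_lge0 ?invr_gt0// subr_ge0.
Qed.

Lemma norm_mean_mul_le X Y : square_integrable X -> square_integrable Y ->
  `|\int[P]_w (X w * Y w)| <=
  Num.sqrt (\int[P]_w (X w * X w)) * Num.sqrt (\int[P]_w (Y w * Y w)).
Proof.
move=> sX sY; rewrite -sqrtrM ?mean_sqr_ge0// -sqrtr_sqr.
by rewrite ler_wsqrtr// cauchy_schwarz_mean.
Qed.

(** Completeness of [L^2] when the pointwise limit is already known: Fatou's
    lemma turns the Cauchy estimate into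
    convergence in mean square. *)
Lemma mean_square_limit (S : nat -> T -> R) Y :
  (forall n, square_integrable (S n)) -> measurable_fun setT Y ->
  {ae P, forall w, S n w @[n --> \oo] --> Y w} ->
  (forall e, 0 < e -> exists N, forall n m, (N <= n)%N -> (N <= m)%N ->
     \int[P]_w ((S m w - S n w) * (S m w - S n w)) <= e) ->
  square_integrable Y /\
  \int[P]_w ((Y w - S n w) * (Y w - S n w)) @[n --> \oo] --> (0 : R).
Proof.
move=> sS mY SY cau.
have key e N n : (N <= n)%N -> (forall m, (N <= m)%N ->
     \int[P]_w ((S m w - S n w) * (S m w - S n w)) <= e) ->
    (\int[P]_w ((Y w - S n w) ^+ 2)%:E <= e%:E)%E.
  move=> Nn HN.
  pose f m w := ((S (m + N)%N w - S n w) ^+ 2)%:E.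
  have mf m : measurable_fun setT (f m).
    apply/measurable_EFinP; apply: measurable_funX; apply: measurable_funB.
      by case: (sS (m + N)%N).
    by case: (sS n).
  have f0 m w : setT w -> (0 <= f m w)%E by move=> _; rewrite lee_fin sqr_ge0.
  have -> : (\int[P]_w ((Y w - S n w) ^+ 2)%:E =
      \int[P]_w (limn_einf (f ^~ w)))%E.
    apply: ae_eq_integral => //.
    - apply/measurable_EFinP; apply: measurable_funX; apply: measurable_funB => //.
      by case: (sS n).
    - apply: measurableT_comp => //; apply: measurable_fun_limn_esup => m.
      exact: measurableT_comp.
    - apply: filterS SY => w Sw _; apply/esym.
      apply: (cvg_limn_einf_sup _).1; apply: cvg_EFin; first by near=> m.
      have h : S (m + N)%N w @[m --> \oo] --> Y w.
        by move: Sw; rewrite -(cvg_shiftn N).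
      have h2 : S (m + N)%N w - S n w @[m --> \oo] --> Y w - S n w.
        by apply: cvgB => //; exact: cvg_cst.
      by rewrite /f /= expr2; under eq_fun do rewrite expr2; exact: (cvgM h2 h2).
  apply: le_trans (fatou _ _ mf f0) _ => //.
  rewrite limn_einf_lim; apply: lime_le; first exact: is_cvg_einfs.
  apply: nearW => m; apply: (@le_trans _ _ (\int[P]_w f m w)%E).
    by apply: ereal_inf_lbound; exists m => /=.
  have sD := square_integrableB (sS (m + N)%N) (sS n).
  rewrite -[leLHS]fineK; last by apply: integrable_fin_num => //; exact: sD.2.
  rewrite lee_fin; apply: le_trans (HN (m + N)%N (leq_addl _ _)).
  by rewrite le_eqVlt; apply/orP; left; apply/eqP; congr fine; apply: eq_integral.
have sYS n : square_integrable (fun w => Y w - S n w) -> square_integrable Y.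
  move=> h; have := square_integrableD h (sS n); congr square_integrable.
  by apply/funext => w; rewrite subrK.
have sD e N n : (N <= n)%N -> (forall m, (N <= m)%N ->
     \int[P]_w ((S m w - S n w) * (S m w - S n w)) <= e) ->
    square_integrable (fun w => Y w - S n w).
  move=> Nn HN; have mD : measurable_fun setT (fun w => Y w - S n w).
    by apply: measurable_funB => //; case: (sS n).
  split => //; apply/integrableP; split.
    by apply/measurable_EFinP; exact: measurable_funX.
  under eq_integral do rewrite gee0_abs ?lee_fin ?sqr_ge0//.
  exact: le_lt_trans (key e N n Nn HN) (ltry _).
split.
  have [N HN] := cau 1 ltr01.
  by apply: (sYS N); apply: (sD 1 N N) => // m Nm; exact: HN.
apply/cvgr0Pnorm_le => e e0; have [N HN] := cau e e0.
near=> n; have Nn : (N <= n)%N by near: n; exists N.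
rewrite ger0_norm ?mean_sqr_ge0//.
have Hn m : (N <= m)%N -> \int[P]_w ((S m w - S n w) * (S m w - S n w)) <= e.
  exact: HN.
have := key e N n Nn Hn; have sDn := sD e N n Nn Hn.
rewrite -[X in (X <= _)%E]fineK; last by apply: integrable_fin_num => //; exact: sDn.2.
rewrite lee_fin; apply: le_trans.
by rewrite le_eqVlt; apply/orP; left; apply/eqP; congr fine; apply: eq_integral.
Unshelve. all: by end_near. Qed.

Lemma mean_mul_cvg (S S' : nat -> T -> R) Y Y' :
  (forall n, square_integrable (S n)) -> (forall n, square_integrable (S' n)) ->
  square_integrable Y -> square_integrable Y' ->
  \int[P]_w ((Y w - S n w) * (Y w - S n w)) @[n --> \oo] --> (0 : R) ->
  \int[P]_w ((Y' w - S' n w) * (Y' w - S' n w)) @[n --> \oo] --> (0 : R) ->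
  \int[P]_w (S n w * S' n w) @[n --> \oo] --> \int[P]_w (Y w * Y' w).
Proof.
move=> sS sS' sY sY' h h'.
pose U n w := Y w - S n w; pose U' n w := Y' w - S' n w.
have sU n : square_integrable (U n) by exact: square_integrableB.
have sU' n : square_integrable (U' n) by exact: square_integrableB.
pose a n := Num.sqrt (\int[P]_w (U n w * U n w)).
pose a' n := Num.sqrt (\int[P]_w (U' n w * U' n w)).
have ha : a n @[n --> \oo] --> (0 : R).
  rewrite -(sqrtr0 R); apply: (cvg_comp _ _ h); exact: sqrt_continuous.
have ha' : a' n @[n --> \oo] --> (0 : R).
  rewrite -(sqrtr0 R); apply: (cvg_comp _ _ h'); exact: sqrt_continuous.
pose y := Num.sqrt (\int[P]_w (Y w * Y w)).
pose y' := Num.sqrt (\int[P]_w (Y' w * Y' w)).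
apply/subr_cvg0.
have hb : a n * y' + a' n * y + a n * a' n @[n --> \oo] --> (0 : R).
  have -> : 0 = 0 * y' + 0 * y + 0 * 0 :> R by rewrite !mul0r !addr0.
  by apply: cvgD; [apply: cvgD; apply: cvgMl|apply: cvgM].
apply/norm_cvg0P; apply: (squeeze_cvgr (f := fun=> 0) _ _ hb); last exact: cvg_cst.
near=> n; rewrite normr_ge0/=.
have E : \int[P]_w (Y w * Y' w) = \int[P]_w (S n w * S' n w) +
   \int[P]_w (U n w * Y' w) + \int[P]_w (U' n w * Y w) - \int[P]_w (U n w * U' n w).
  rewrite -RintegralD//; try exact: square_integrableM.
  rewrite -RintegralD//; try exact: square_integrableM; last first.
    apply: (@integrableD _ _ _ P setT measurableT
      (EFin \o (fun w => S n w * S' n w)) (EFin \o (fun w => U n w * Y' w)));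
      exact: square_integrableM.
  rewrite -RintegralB//; try exact: square_integrableM; last first.
    apply: (@integrableD _ _ _ P setT measurableT
      (EFin \o (fun w => S n w * S' n w + U n w * Y' w))
      (EFin \o (fun w => U' n w * Y w))); last exact: square_integrableM.
    apply: (@integrableD _ _ _ P setT measurableT
      (EFin \o (fun w => S n w * S' n w)) (EFin \o (fun w => U n w * Y' w)));
      exact: square_integrableM.
  by apply: eq_Rintegral => w _; rewrite /U /U'; ring.
have -> : \int[P]_w (S n w * S' n w) - \int[P]_w (Y w * Y' w) =
  - (\int[P]_w (U n w * Y' w)) - \int[P]_w (U' n w * Y w) +
    \int[P]_w (U n w * U' n w) by rewrite E; ring.
have h1 := norm_mean_mul_le (sU n) sY'.
have h2 := norm_mean_mul_le (sU' n) sY.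
have h3 := norm_mean_mul_le (sU n) (sU' n).
apply: le_trans (ler_normD _ _) _; apply: lerD => //.
by apply: le_trans (ler_normB _ _) _; rewrite normrN; apply: lerD.
Unshelve. all: by end_near. Qed.

End square_integrable.

(** * Sums of Brownian increments *)

Section brownian_sums.
Context (d : measure_display) (T : measurableType d) (R : realType).
Variables (P : probability T R) (B : R -> T -> R).
Hypothesis BM : brownian_motion P B.
Implicit Types (s t u v z : R) (c : nat -> R).

Definition increment s t (w : T) : R := B t w - B s w.

Lemma measurable_increment s t : 0 <= s -> 0 <= t ->
  measurable_fun setT (increment s t).
Proof.
by move=> s0 t0; apply: measurable_funB; apply: (brownian_measurable BM).
Qed.

Lemma ge0_mean_increment (f : R -> R) s t : 0 <= s -> s < t ->
  (forall x, 0 <= f x) -> measurable_fun setT f ->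
  (\int[P]_w (f (increment s t w))%:E =
   \int[normal_prob 0 (Num.sqrt (t - s))]_x (f x)%:E)%E.
Proof.
move=> s0 st f0 mf.
have mD : measurable_fun setT (increment s t).
  by apply: measurable_increment => //; lra.
have /measurable_EFinP mfE := mf.
pose D := (increment s t : T -> measurableTypeR R).
have mD' : measurable_fun setT D := mD.
rewrite -[LHS]/(\int[P]_(w in D @^-1` setT) ((EFin \o f) \o D) w)%E.
rewrite -(ge0_integral_pushforward mD')//=; last by move=> x _; rewrite lee_fin.
apply: eq_measure_integral => A mA _ /=.
by rewrite -(brownian_gaussian BM s0 st mA).
Qed.

Lemma increment_lt_moments s t : 0 <= s -> s < t ->
  [/\ square_integrable P (increment s t),
      \int[P]_w (increment s t w * increment s t w) = t - s &
      \int[P]_w (increment s t w) = 0].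
Proof.
move=> s0 st; have ts : 0 < Num.sqrt (t - s) by rewrite sqrtr_gt0 subr_gt0.
have m2 : (\int[P]_w (increment s t w ^+ 2)%:E = (t - s)%:E)%E.
  have mX : measurable_fun setT (fun x : R => x ^+ 2) by exact: measurable_funX.
  rewrite (ge0_mean_increment s0 st (fun x => sqr_ge0 x) mX).
  by rewrite normal_prob_second_moment// sqr_sqrtr// subr_ge0 ltW.
have mD : measurable_fun setT (increment s t).
  by apply: measurable_increment => //; lra.
have sD : square_integrable P (increment s t).
  split => //; apply/integrableP; split.
    by apply/measurable_EFinP; exact: measurable_funX.
  under eq_integral do rewrite gee0_abs ?lee_fin ?sqr_ge0//.
  by rewrite m2 ltry.
split => //.
  by rewrite /Rintegral; under eq_integral do rewrite -expr2; rewrite m2.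
have mp : measurable_fun setT (fun x : R => Num.max x 0).
  by apply: measurable_maxr.
have mn : measurable_fun setT (fun x : R => Num.max (- x) 0).
  by apply: measurable_maxr.
have iD := square_integrable1 sD.
have ip : P.-integrable setT (EFin \o (fun w => Num.max (increment s t w) 0)).
  apply: (le_integrable measurableT _ _ iD).
    by apply/measurable_EFinP; exact: (measurableT_comp mp mD).
  move=> w _ /=; rewrite lee_fin ger0_norm ?le_max ?lexx ?orbT//.
  by rewrite ge_max ler_norm normr_ge0.
have inn : P.-integrable setT (EFin \o (fun w => Num.max (- increment s t w) 0)).
  apply: (le_integrable measurableT _ _ iD).
    by apply/measurable_EFinP; exact: (measurableT_comp mn mD).
  move=> w _ /=; rewrite lee_fin ger0_norm ?le_max ?lexx ?orbT//.
  by rewrite ge_max -normrN ler_norm normr_ge0.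
have -> : \int[P]_w increment s t w = \int[P]_w (Num.max (increment s t w) 0 -
    Num.max (- increment s t w) 0).
  apply: eq_Rintegral => w _; move: (increment s t w) => x.
  by case: (leP x 0) => x0; case: (leP (- x) 0) => x1; lra.
rewrite RintegralB//; apply/eqP; rewrite subr_eq0; apply/eqP; congr fine.
rewrite (@ge0_mean_increment (fun x => Num.max x 0))//; last first.
  by move=> x; rewrite le_max lexx orbT.
rewrite (@ge0_mean_increment (fun x => Num.max (- x) 0))//; last first.
  by move=> x; rewrite le_max lexx orbT.
exact: normal_prob_first_moment_parts.
Qed.

Lemma increment_moments s t : 0 <= s -> 0 <= t ->
  [/\ square_integrable P (increment s t),
      \int[P]_w (increment s t w * increment s t w) = `|t - s| &
      \int[P]_w (increment s t w) = 0].
Proof.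
move=> s0 t0; have [st|ts|->] := ltgtP s t.
- have [h1 h2 h3] := increment_lt_moments s0 st; split=> //.
  by rewrite h2 ger0_norm// subr_ge0 ltW.
- have [h1 h2 h3] := increment_lt_moments t0 ts.
  have E : increment s t = fun w => -1 * increment t s w.
    by apply/funext => w; rewrite /increment mulN1r opprB.
  rewrite E; split; first exact: square_integrableZ.
    rewrite distrC ger0_norm ?subr_ge0 1?ltW// -h2.
    by apply: eq_Rintegral => w _; rewrite mulN1r mulrNN.
  rewrite RintegralZl//; first by rewrite h3 mulr0.
  exact: square_integrable1.
- have -> : increment t t = fun=> 0.
    by apply/funext => w; rewrite /increment subrr.
  split; first exact: square_integrable_cst.
    by rewrite mul0r Rintegral_cst// mul0r subrr normr0.
  by rewrite Rintegral_cst// mul0r.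
Qed.

Lemma square_integrable_increment s t : 0 <= s -> 0 <= t ->
  square_integrable P (increment s t).
Proof. by move=> s0 t0; have [] := increment_moments s0 t0. Qed.

(** By polarisation, the covariance of two increments only involves variances
    of increments; orthogonality over disjoint intervals is a special case. *)
Lemma mean_increment_mul s t u v : 0 <= s -> 0 <= t -> 0 <= u -> 0 <= v ->
  \int[P]_w (increment s t w * increment u v w) =
  (`|v - s| - `|u - s| - `|v - t| + `|u - t|) / 2.
Proof.
move=> s0 t0 u0 v0.
have [a1 <- _] := increment_moments s0 v0; have [a2 <- _] := increment_moments s0 u0.
have [a3 <- _] := increment_moments t0 v0; have [a4 <- _] := increment_moments t0 u0.
have i1 := square_integrableM a1 a1; have i2 := square_integrableM a2 a2.
have i3 := square_integrableM a3 a3; have i4 := square_integrableM a4 a4.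
have i12 := integrableB measurableT i1 i2.
have i123 := integrableB measurableT i12 i3.
have i1234 := integrableD measurableT i123 i4.
rewrite -RintegralB// -RintegralB// -RintegralD// -RintegralZr//.
by apply: eq_Rintegral => w _; rewrite /increment; field.
Qed.

Definition step_sum u v n c (w : T) : R :=
  \sum_(i < 2 ^ n) c i * increment (dyadic u v n i) (dyadic u v n i.+1) w.

Lemma dyadic_ge0 u v n i : 0 <= u -> u <= v -> 0 <= dyadic u v n i.
Proof.
move=> u0 uv; apply: le_trans u0 _; have := dyadic_mono n uv (leq0n i).
by rewrite dyadic0.
Qed.

Lemma square_integrable_step_sum u v n c : 0 <= u -> u <= v ->
  square_integrable P (step_sum u v n c).
Proof.
move=> u0 uv; apply: square_integrable_sum => i.
by apply/square_integrableZ/square_integrable_increment; exact: dyadic_ge0.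
Qed.

Lemma mean_dyadic_increment_mul u v n i j : 0 <= u -> u <= v ->
  \int[P]_w (increment (dyadic u v n i) (dyadic u v n i.+1) w *
    increment (dyadic u v n j) (dyadic u v n j.+1) w) =
  if i == j then (v - u) / (2 ^ n)%:R else 0.
Proof.
move=> u0 uv; rewrite mean_increment_mul ?dyadic_ge0//.
have m k l : (k <= l)%N -> 0 <= dyadic u v n l - dyadic u v n k.
  by move=> kl; rewrite subr_ge0 dyadic_mono.
case: ltngtP => [ij|ji|->].
- rewrite (ger0_norm (m i j.+1 (leqW (ltnW ij)))) (ger0_norm (m i j (ltnW ij))).
  rewrite (ger0_norm (m i.+1 j.+1 (leqW ij))) (ger0_norm (m i.+1 j ij)).
  by field.
- rewrite distrC (ger0_norm (m j.+1 i ji)) distrC (ger0_norm (m j i (ltnW ji))).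
  rewrite distrC (ger0_norm (m j.+1 i.+1 (leqW ji))).
  rewrite distrC (ger0_norm (m j i.+1 (leqW (ltnW ji)))).
  by field.
- rewrite subrr normr0 [`|dyadic u v n j - _|]distrC.
  rewrite (ger0_norm (m j j.+1 (leqnSn j))) dyadic_step subrr normr0; field.
  by rewrite gt_eqF ?pow2_gt0.
Qed.

(** Discrete Ito isometry. *)
Lemma mean_step_sum_mul u v n c c' : 0 <= u -> u <= v ->
  \int[P]_w (step_sum u v n c w * step_sum u v n c' w) =
  \sum_(i < 2 ^ n) c i * c' i * ((v - u) / (2 ^ n)%:R).
Proof.
move=> u0 uv.
have sI i : square_integrable P (increment (dyadic u v n i) (dyadic u v n i.+1)).
  by apply: square_integrable_increment; exact: dyadic_ge0.
rewrite mean_mul_suml; last 2 first.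
- by move=> i; exact: square_integrableZ.
- exact: square_integrable_step_sum.
apply: eq_bigr => i _; rewrite mean_mulZl//; last exact: square_integrable_step_sum.
rewrite -mulrA; congr (_ * _); rewrite mean_mulC mean_mul_suml//; last first.
  by move=> j; exact: square_integrableZ.
rewrite (bigD1 i)//= mean_mulZl// mean_dyadic_increment_mul// eqxx big1 ?addr0//.
move=> j ji; rewrite mean_mulZl// mean_dyadic_increment_mul//.
by rewrite val_eqE (negbTE ji) mulr0.
Qed.

Lemma mean_step_sum_mul_disjoint u v z n m c c' : 0 <= u -> u <= v -> v <= z ->
  \int[P]_w (step_sum u v n c w * step_sum v z m c' w) = 0.
Proof.
move=> u0 uv vz; have v0 : 0 <= v by lra.
have sI i : square_integrable P (increment (dyadic u v n i) (dyadic u v n i.+1)).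
  by apply: square_integrable_increment; exact: dyadic_ge0.
have sI' i : square_integrable P (increment (dyadic v z m i) (dyadic v z m i.+1)).
  by apply: square_integrable_increment; exact: dyadic_ge0.
rewrite mean_mul_suml; last 2 first.
- by move=> i; exact: square_integrableZ.
- exact: square_integrable_step_sum.
apply: big1 => i _; rewrite mean_mulZl//; last exact: square_integrable_step_sum.
rewrite mean_mulC mean_mul_suml//; last first.
  by move=> j; exact: square_integrableZ.
rewrite big1 ?mulr0// => j _; rewrite mean_mulZl// mean_increment_mul ?dyadic_ge0//.
have /andP[_ h1] := dyadic_itv uv (ltnW (ltn_ord i)).
have /andP[_ h2] := dyadic_itv uv (ltn_ord i).
have /andP[h3 _] := dyadic_itv vz (ltnW (ltn_ord j)).
have /andP[h4 _] := dyadic_itv vz (ltn_ord j).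
have h13 := le_trans h1 h3; have h14 := le_trans h1 h4.
have h23 := le_trans h2 h3; have h24 := le_trans h2 h4.
rewrite !ler0_norm ?subr_le0 ?h13 ?h14 ?h23 ?h24//.
by rewrite [X in _ * X](_ : _ = 0) ?mulr0//; field.
Qed.

Lemma mean_step_sum u v n c : 0 <= u -> u <= v ->
  \int[P]_w step_sum u v n c w = 0.
Proof.
move=> u0 uv.
have sI i : square_integrable P (increment (dyadic u v n i) (dyadic u v n i.+1)).
  by apply: square_integrable_increment; exact: dyadic_ge0.
transitivity (\int[P]_w (step_sum u v n c w * (fun=> 1) w)).
  by apply: eq_Rintegral => w _; rewrite mulr1.
rewrite mean_mul_suml; last 2 first.
- by move=> i; exact: square_integrableZ.
- exact: square_integrable_cst.
apply: big1 => i _; rewrite mean_mulZl//; last exact: square_integrable_cst.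
under eq_Rintegral do rewrite mulr1.
by have [_ _ ->] := increment_moments (dyadic_ge0 n i u0 uv)
  (dyadic_ge0 n i.+1 u0 uv); rewrite mulr0.
Qed.

Lemma sum_blocks (V : nmodType) (F : nat -> V) (N K : nat) :
  \sum_(j < N * K) F j = \sum_(i < N) \sum_(k < K) F (i * K + k)%N.
Proof.
elim: N => [|N IH]; first by rewrite mul0n !big_ord0.
rewrite big_ord_recr/= -IH mulSn addnC big_split_ord/=.
by [].
Qed.

(** Two step sums on different grids become comparable once both are written on
    the finer one, where the Brownian increments of a coarse cell telescope. *)
Lemma step_sum_refine u v n k c w :
  step_sum u v n c w = step_sum u v (n + k) (fun j => c (j %/ 2 ^ k)%N) w.
Proof.
rewrite /step_sum expnD (sum_blocks (fun j => c (j %/ 2 ^ k)%N *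
  increment (dyadic u v (n + k) j) (dyadic u v (n + k) j.+1) w)).
apply: eq_bigr => i _.
have k0 : (0 < 2 ^ k)%N by rewrite expn_gt0.
have E l : dyadic u v (n + k) (l * 2 ^ k) = dyadic u v n l.
  have kn : (2 ^ k)%:R != 0 :> R by rewrite gt_eqF ?pow2_gt0.
  by rewrite /dyadic expnD !natrM invfM mulrACA divff// mulr1.
under [RHS]eq_bigr => j _ do rewrite divnMDl// divn_small// addn0.
rewrite -mulr_sumr; congr (_ * _).
rewrite -(big_mkord xpredT (fun j => increment (dyadic u v (n + k) (i * 2 ^ k + j))
  (dyadic u v (n + k) (i * 2 ^ k + j).+1) w)).
under eq_bigr => j _ do rewrite -addnS.
rewrite (telescope_sumr (fun j => B (dyadic u v (n + k) (i * 2 ^ k + j)) w))//.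
by rewrite addn0 -mulSnr !E.
Qed.

Definition wiener_sum (f : R -> R) u v n : T -> R :=
  step_sum u v n (fun i => f (dyadic u v n i)).

(** On a common grid the difference of two sums has coefficients bounded by the
    modulus of continuity of [f], so its second moment is small. *)
Lemma wiener_sum_cauchy (f : R -> R) u v : 0 <= u -> u <= v ->
  {within `[u, v], continuous f} ->
  forall e, 0 < e -> exists N, forall n m, (N <= n)%N -> (N <= m)%N ->
    \int[P]_w ((wiener_sum f u v m w - wiener_sum f u v n w) *
      (wiener_sum f u v m w - wiener_sum f u v n w)) <= e.
Proof.
move=> u0 uv cf e e0.
have w1 : 0 < v - u + 1 by lra.
have r0 : 0 < Num.sqrt (e / (v - u + 1)) by rewrite sqrtr_gt0 divr_gt0.
have [r rp Hr] := segment_uniform_continuity cf r0.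
have : (v - u) * ((2 ^ n)%:R : R)^-1 @[n --> \oo] --> (v - u) * 0.
  by apply: cvgMr; exact: cvg_inv_pow2.
rewrite mulr0 => /cvgr0Pnorm_lt/(_ r rp) [N _ HN].
exists N => n m.
wlog nm : n m / (n <= m)%N.
  move=> h Nn Nm; have [/h|/ltnW/h h'] := leqP n m; first exact.
  by apply: le_trans (h' Nm Nn); rewrite le_eqVlt; apply/orP; left; apply/eqP;
    apply: eq_Rintegral => w _; ring.
move=> Nn Nm; rewrite -(subnKC nm); set k := (m - n)%N.
pose c j := f (dyadic u v (n + k) j) - f (dyadic u v n (j %/ 2 ^ k)).
have E w : wiener_sum f u v (n + k) w - wiener_sum f u v n w =
    step_sum u v (n + k) c w.
  rewrite /wiener_sum (step_sum_refine u v n k) /step_sum -sumrB.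
  by apply: eq_bigr => j _; rewrite mulrBl.
under eq_Rintegral do rewrite !E.
rewrite mean_step_sum_mul//.
apply: (@le_trans _ _ (\sum_(i < 2 ^ (n + k)) e / (v - u + 1) *
  ((v - u) / (2 ^ (n + k))%:R))).
  apply: ler_sum => j _; apply: ler_wpM2r.
    by rewrite divr_ge0 ?subr_ge0// ltW// pow2_gt0.
  rewrite -expr2 -[leRHS]sqr_sqrtr ?divr_ge0 ?(ltW w1) ?(ltW e0)//.
  rewrite -[leLHS]real_normK ?num_real// lerXn2r ?nnegrE ?(ltW r0)//.
  have k0 : (0 < 2 ^ k)%N by rewrite expn_gt0.
  have jk : (j %/ 2 ^ k < 2 ^ n)%N by rewrite ltn_divLR// -expnD.
  apply/ltW/Hr; [exact/dyadic_itv/ltnW| exact/dyadic_itv/ltnW|].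
  have E2 l : dyadic u v n l = dyadic u v (n + k) (l * 2 ^ k).
    have kn : (2 ^ k)%:R != 0 :> R by rewrite gt_eqF ?pow2_gt0.
    by rewrite /dyadic expnD !natrM invfM mulrACA divff// mulr1.
  have h1 : dyadic u v n (j %/ 2 ^ k) <= dyadic u v (n + k) j.
    by rewrite E2 dyadic_mono// leq_divM.
  have h2 : dyadic u v (n + k) j <= dyadic u v n (j %/ 2 ^ k).+1.
    by rewrite E2 dyadic_mono// ltnW// ltn_ceil.
  have h3 := dyadic_step u v n (j %/ 2 ^ k).
  rewrite ger0_norm ?subr_ge0//.
  apply: (@le_lt_trans _ _ ((v - u) / (2 ^ n)%:R)); first by lra.
  by apply: le_lt_trans (ler_norm _) (HN n Nn).
rewrite sumr_const card_ord -[leLHS]mulr_natr.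
have n0 : (2 ^ (n + k))%:R != 0 :> R by rewrite gt_eqF ?pow2_gt0.
have -> : e / (v - u + 1) * ((v - u) / (2 ^ (n + k))%:R) * (2 ^ (n + k))%:R =
  e * ((v - u) / (v - u + 1)) by field; rewrite n0 gt_eqF.
by rewrite ler_piMr ?(ltW e0)// ler_pdivrMr// mul1r lerDl.
Qed.

End brownian_sums.

(** * Covariance of the solution *)

Section solution_covariance.
Context (d : measure_display) (T : measurableType d) (R : realType).
Variables (P : probability T R) (F : R -> set (set T)) (B : R -> T -> R).
Variables (a b sigma : R) (psi : R -> R) (X : R -> T -> R).
Hypothesis F_usual : usual_filtration P F.
Hypothesis BM : brownian_motion P B.
Hypothesis X_solution : average_sde_solution P F B a b sigma psi X.
Notation mu := (@lebesgue_measure R).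
Implicit Types (t u v : R) (p q : R -> R).

Lemma measurable_solution t : 0 <= t -> measurable_fun setT (X t).
Proof.
move=> t0 _ A mA; rewrite setTI; apply: (filtration_measurable F_usual t0).
exact: (solution_adapted X_solution).
Qed.

Definition solution_pairing p q v (w : T) : R :=
  p v * (\int[mu]_(r in `[-1, v]) X r w) + q v * X v w.

Definition solution_mean p q : R :=
  p 0 * (\int[mu]_(r in `[-1, 0]) psi r) + q 0 * psi 0.

(** The limit of the sums on the left is the Wiener integral of [sigma q]; it
    exists path by path because [q] is smooth. *)
Lemma wiener_sum_pairing t p q u v : 0 < t -> adjoint_pair a b t p q ->
  0 <= u -> u <= v -> v <= t ->
  {ae P, forall w, wiener_sum B (fun s => sigma * q s) u v n w @[n --> \oo] -->
     solution_pairing p q v w - solution_pairing p q u w}.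
Proof.
move=> t0 pq u0 uv vt.
have cX := solution_continuous X_solution.
have cB := brownian_continuous BM.
have eqX := solution_equation X_solution.
apply: filterS3 cX cB eqX => w cXw cBw eqXw.
have := adjoint_path_sums t0 u0 uv vt pq cXw cBw eqXw.
apply: cvg_trans; apply: near_eq_cvg; near=> n.
by apply: eq_bigr => i _; rewrite mulrA.
Unshelve. all: by end_near. Qed.

Lemma pairing_start p q :
  {ae P, forall w, solution_pairing p q 0 w = solution_mean p q}.
Proof.
apply: filterS (solution_initial X_solution) => w Xw.
rewrite /solution_pairing /solution_mean Xw ?in_itv/= ?lexx ?lerN10//.
congr (_ * _ + _); apply: eq_Rintegral => s; rewrite inE/= => sI.
exact: Xw.
Qed.

Lemma pairing_end t p q w : adjoint_pair a b t p q ->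
  solution_pairing p q t w = X t w.
Proof. by case=> pt qt _ _; rewrite /solution_pairing pt qt mul0r add0r mul1r. Qed.

Lemma adjoint_continuous t p q : adjoint_pair a b t p q ->
  {within `[0, t], continuous q}.
Proof. by case=> _ _ _ dq; exact: is_derive_within_continuous dq. Qed.

Lemma cauchy_add (S S' : nat -> T -> R) :
  (forall n, square_integrable P (S n)) -> (forall n, square_integrable P (S' n)) ->
  (forall e, 0 < e -> exists N, forall n m, (N <= n)%N -> (N <= m)%N ->
     \int[P]_w ((S m w - S n w) * (S m w - S n w)) <= e) ->
  (forall e, 0 < e -> exists N, forall n m, (N <= n)%N -> (N <= m)%N ->
     \int[P]_w ((S' m w - S' n w) * (S' m w - S' n w)) <= e) ->
  forall e, 0 < e -> exists N, forall n m, (N <= n)%N -> (N <= m)%N ->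
     \int[P]_w ((S m w + S' m w - (S n w + S' n w)) *
       (S m w + S' m w - (S n w + S' n w))) <= e.
Proof.
move=> sS sS' cS cS' e e0; have e4 : 0 < e / 4 by lra.
have [N HN] := cS _ e4; have [N' HN'] := cS' _ e4.
exists (maxn N N') => n m; rewrite !geq_max => /andP[Nn N'n] /andP[Nm N'm].
have sU := square_integrableB (sS m) (sS n).
have sU' := square_integrableB (sS' m) (sS' n).
have h1 := HN n m Nn Nm; have h2 := HN' n m N'n N'm.
have iU := square_integrableM sU sU; have iU' := square_integrableM sU' sU'.
have sW := square_integrableB (square_integrableD (sS m) (sS' m))
  (square_integrableD (sS n) (sS' n)).
apply: (@le_trans _ _ (\int[P]_w (2 * ((S m w - S n w) * (S m w - S n w)) +
   2 * ((S' m w - S' n w) * (S' m w - S' n w))))).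
  apply: le_Rintegral => //.
  - exact: square_integrableM.
  - apply: (integrableD measurableT (integrableZl measurableT 2 iU)
      (integrableZl measurableT 2 iU')).
  - move=> w _; rewrite -subr_ge0.
    have := sqr_ge0 ((S m w - S n w) - (S' m w - S' n w)).
    by move/le_trans; apply; rewrite le_eqVlt; apply/orP; left; apply/eqP; ring.
rewrite RintegralD//; last 2 first.
- exact: (integrableZl measurableT 2 iU).
- exact: (integrableZl measurableT 2 iU').
rewrite !RintegralZl//; lra.
Qed.

(** Ito isometry for the solution: both variables are mean-square limits of
    step sums; beyond time [t] the sums for [X (t + Delta)] are orthogonal to
    those for [X t]. *)
Lemma solution_covariance t Delta p q p' q' (Phi : R -> R) :
  0 < t -> 0 <= Delta ->
  adjoint_pair a b t p q -> adjoint_pair a b (t + Delta) p' q' ->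
  {within `[0, t], continuous Phi} ->
  (forall s, 0 < s < t -> is_derive s 1 Phi (q s * q' s)) ->
  covariance P (X t) (X (t + Delta)) = (sigma ^+ 2 * (Phi t - Phi 0))%:E.
Proof.
move=> t0 D0 pq pq' cPhi dPhi.
have t0' := ltW t0.
pose t' := t + Delta.
have t'0 : 0 < t' by rewrite ltr_wpDr.
have tt' : t <= t' by rewrite lerDl.
have cq := adjoint_continuous pq; have cq' := adjoint_continuous pq'.
have cq1 : {within `[0, t], continuous q'}.
  by apply: continuous_subspaceW cq'; apply: subset_itvl; rewrite bnd_simp.
have cq2 : {within `[t, t'], continuous q'}.
  by apply: continuous_subspaceW cq'; apply: subset_itvr; rewrite bnd_simp.
pose m := solution_mean p q; pose m' := solution_mean p' q'.
pose Y w := X t w - m; pose Y' w := X t' w - m'.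
pose S n := wiener_sum B (fun s => sigma * q s) 0 t n.
pose S1 n := wiener_sum B (fun s => sigma * q' s) 0 t n.
pose S2 n := wiener_sum B (fun s => sigma * q' s) t t' n.
pose S' n w := S1 n w + S2 n w.
have sS n : square_integrable P (S n) by exact: square_integrable_step_sum.
have sS1 n : square_integrable P (S1 n) by exact: square_integrable_step_sum.
have sS2 n : square_integrable P (S2 n) by exact: square_integrable_step_sum.
have sS' n : square_integrable P (S' n) by exact: square_integrableD.
have mY : measurable_fun setT Y.
  by apply: measurable_funB; [exact: measurable_solution|exact: measurable_cst].
have mY' : measurable_fun setT Y'.
  apply: measurable_funB; last exact: measurable_cst.
  exact: (measurable_solution (ltW t'0)).
have SY : {ae P, forall w, S n w @[n --> \oo] --> Y w}.
  have h := wiener_sum_pairing t0 pq (lexx 0) t0' (lexx t).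
  apply: filterS2 h (pairing_start p q) => w h E.
  by rewrite /Y -(pairing_end w pq) /m -E.
have SY' : {ae P, forall w, S' n w @[n --> \oo] --> Y' w}.
  have h1 := wiener_sum_pairing t'0 pq' (lexx 0) t0' tt'.
  have h2 := wiener_sum_pairing t'0 pq' t0' tt' (lexx t').
  apply: filterS3 h1 h2 (pairing_start p' q') => w h1 h2 E.
  have -> : Y' w = solution_pairing p' q' t w - solution_pairing p' q' 0 w +
      (solution_pairing p' q' t' w - solution_pairing p' q' t w).
    by rewrite /Y' -(pairing_end w pq') E -/t' -/m'; ring.
  exact: cvgD h1 h2.
have cs (r : R -> R) (u v : R) : {within `[u, v], continuous r} ->
    {within `[u, v], continuous (fun s => sigma * r s)}.
  by move=> cr s; apply: cvgMr; exact: cr.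
have cauS := wiener_sum_cauchy BM (lexx 0) t0' (cs _ _ _ cq).
have cauS1 := wiener_sum_cauchy BM (lexx 0) t0' (cs _ _ _ cq1).
have cauS2 := wiener_sum_cauchy BM t0' tt' (cs _ _ _ cq2).
have cauS' := cauchy_add sS1 sS2 cauS1 cauS2.
have [sY LY] := mean_square_limit sS mY SY cauS.
have [sY' LY'] := mean_square_limit sS' mY' SY' cauS'.
have lim1 := mean_mul_cvg sS sS' sY sY' LY LY'.
have lim2 : \int[P]_w (S n w * S' n w) @[n --> \oo] -->
    sigma ^+ 2 * (Phi t - Phi 0).
  have cqq : {within `[0, t], continuous (fun s => q s * q' s)}.
    by move=> s; apply: cvgM; [exact: cq|exact: cq1].
  have h := dyadic_riemann_sum t0' cqq cPhi dPhi.
  rewrite (_ : (fun n => _) = fun n => sigma ^+ 2 * \sum_(i < 2 ^ n)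
      q (dyadic 0 t n i) * q' (dyadic 0 t n i) *
      (dyadic 0 t n i.+1 - dyadic 0 t n i)).
    by apply: cvgMr; exact: h.
  apply/funext => n.
  rewrite mean_mulC /S' mean_mulDl// mean_mulC mean_step_sum_mul//.
  rewrite mean_mulC mean_step_sum_mul_disjoint// addr0 mulr_sumr.
  by apply: eq_bigr => i _; rewrite dyadic_step; ring.
have EYY' : \int[P]_w (Y w * Y' w) = sigma ^+ 2 * (Phi t - Phi 0).
  rewrite -(cvg_lim (@Rhausdorff R) lim1).
  exact: (cvg_lim (@Rhausdorff R) lim2).
have sc := square_integrable_cst P 1.
have cstL : \int[P]_w (((fun=> 1 : R) w - (fun=> 1 : R) w) *
    ((fun=> 1 : R) w - (fun=> 1 : R) w)) @[n --> \oo] --> (0 : R).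
  under eq_fun do under eq_Rintegral do rewrite subrr mul0r.
  by under eq_fun do rewrite Rintegral_cst// mul0r; exact: cvg_cst.
have mean0 (S0 : nat -> T -> R) (Y0 : T -> R) :
    (forall n, square_integrable P (S0 n)) -> square_integrable P Y0 ->
    \int[P]_w ((Y0 w - S0 n w) * (Y0 w - S0 n w)) @[n --> \oo] --> (0 : R) ->
    (forall n, \int[P]_w S0 n w = 0) -> \int[P]_w Y0 w = 0.
  move=> s1 s2 l z.
  have := mean_mul_cvg s1 (fun=> sc) s2 sc l cstL.
  under eq_fun do under eq_Rintegral do rewrite mulr1.
  under eq_Rintegral do rewrite mulr1.
  under eq_fun do rewrite z.
  move=> h; rewrite -(cvg_lim (@Rhausdorff R) h).
  exact: (cvg_lim (@Rhausdorff R) (@cvg_cst _ (0 : R) _ _ _)).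
have EY : \int[P]_w Y w = 0.
  by apply: (mean0 S) => // n; exact: mean_step_sum.
have EY' : \int[P]_w Y' w = 0.
  apply: (mean0 S') => // n; rewrite RintegralD//; try exact: square_integrable1.
  by rewrite !mean_step_sum// addr0.
have EX (Z : T -> R) c : square_integrable P (fun w => Z w - c) ->
    \int[P]_w (Z w - c) = 0 -> fine 'E_P[Z] = c.
  move=> sZ EZ; rewrite unlock.
  have -> : Z = fun w => (Z w - c) + c by apply/funext => w; rewrite subrK.
  rewrite -[LHS]/(\int[P]_w (Z w - c + c)) RintegralD//.
  - by rewrite EZ add0r Rintegral_cst//= probability_setT mulr1.
  - exact: square_integrable1.
  - exact: (square_integrable1 (square_integrable_cst P c)).
rewrite unlock (EX _ _ sY EY) (EX _ _ sY' EY') unlock -EYY'.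
rewrite fineK//; apply: integrable_fin_num => //.
exact: (square_integrableM sY sY').
Qed.

End solution_covariance.

(** * The resolvent when [a + b = 0] *)

Section critical_kernel.
Context {R : realType}.
Variable a : R.
Hypothesis a_lt0 : a < 0.
Implicit Types (t s y : R).

(** This is [\int_y^oo e^{au} / u^2 du]. *)
Definition critical_tail y : R := - a * gamma_m1 (- a * y).

(** The limit of [critical_resolvent t s] below as [t] grows: a unit of noise at
    time [s] keeps an effect of this size forever. *)
Definition critical_kernel s : R :=
  (1 + s) * expR (- a * (1 + s)) * critical_tail (1 + s).

Definition critical_resolvent t s : R :=
  (1 + s) * expR (- a * (1 + s)) *
  (critical_tail (1 + s) - critical_tail (1 + t) + expR (a * (1 + t)) / (1 + t)).

Let al0 : 0 < - a. Proof. by rewrite oppr_gt0. Qed.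

Let an : a != 0. Proof. by rewrite lt_eqF. Qed.

Lemma is_derive_critical_tail s : 0 <= s ->
  is_derive s 1 (fun r => critical_tail (1 + r)) (- (expR (a * (1 + s)) / (1 + s) ^+ 2)).
Proof.
move=> s0; have s1 : 0 < 1 + s by lra.
have z0 : 0 < - a * (1 + s) by rewrite mulr_gt0.
have dz : is_derive s 1 (fun r => - a * (1 + r)) (- a).
  by eapply is_derive_eq; [derive_rules|ring].
have dG : is_derive s 1 (fun r => gamma_m1 (- a * (1 + r)))
    (- (expR (- (- a * (1 + s))) / (- a * (1 + s)) ^+ 2) * - a).
  exact: (@is_derive1_comp _ _ _ s _ _ (is_derive_gamma_m1 z0) dz).
eapply is_derive_eq; first by rewrite /critical_tail; derive_rules.
rewrite /= (_ : - (- a * (1 + s)) = a * (1 + s)); last by ring.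
by field; rewrite an gt_eqF.
Qed.

(** When [a + b = 0] the function [1 + t] solves the homogeneous equation for
    the running integral, and reduction of order gives the resolvent. *)
Lemma critical_adjoint_pair t : 0 <= t ->
  adjoint_pair a (- a) t (fun s => - ((critical_resolvent t s - 1) / (1 + s)))
    (critical_resolvent t).
Proof.
move=> t0; have t1 : 0 < 1 + t by lra.
have qt : critical_resolvent t t = 1.
  rewrite /critical_resolvent subrr add0r mulNr expRN; field.
  by rewrite !gt_eqF ?expR_gt0.
have dq s : 0 <= s <= t -> is_derive s 1 (critical_resolvent t)
    ((1 / (1 + s) - a) * critical_resolvent t s - 1 / (1 + s)).
  move=> /andP[s0 _]; have s1 : 0 < 1 + s by lra.
  have dc := is_derive_critical_tail s0.
  eapply is_derive_eq; first by rewrite /critical_resolvent; derive_rules.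
  rewrite /critical_resolvent /= mulNr expRN; field.
  by rewrite !gt_eqF ?expR_gt0.
split; [by rewrite qt subrr mul0r oppr0|exact: qt| |].
- move=> s st; have s1 : 1 + s != 0 by rewrite gt_eqF//; lra.
  have := dq s st => dqs.
  by eapply is_derive_eq; [derive_rules|rewrite /=; field].
- move=> s st; have s1 : 1 + s != 0 by rewrite gt_eqF//; lra.
  by apply: (is_derive_eq (dq s st)); field.
Qed.

Lemma critical_tail_bounds y : 0 < y ->
  0 <= critical_tail y <= expR (a * y) / (- a * y ^+ 2).
Proof.
move=> y0; have z0 : 0 < - a * y by rewrite mulr_gt0.
have /andP[h0 _] := gamma_m1_bounds z0; have h1 := gamma_m1_upper z0.
rewrite /critical_tail mulr_ge0 ?(ltW al0)//=.
apply: le_trans (ler_wpM2l (ltW al0) h1) _.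
rewrite (_ : - (- a * y) = a * y); last by ring.
rewrite le_eqVlt; apply/orP; left; apply/eqP; field.
by rewrite an gt_eqF.
Qed.

Lemma critical_kernel_bounds s : 0 <= s ->
  0 <= critical_kernel s <= (- a)^-1 / (1 + s).
Proof.
move=> s0; have s1 : 0 < 1 + s by lra.
have /andP[h0 h1] := critical_tail_bounds s1.
have e0 := expR_gt0 (- a * (1 + s)).
have c0 : 0 <= (1 + s) * expR (- a * (1 + s)) by rewrite mulr_ge0// ltW.
rewrite /critical_kernel mulr_ge0//=.
apply: le_trans (ler_wpM2l c0 h1) _.
rewrite mulNr expRN le_eqVlt; apply/orP; left; apply/eqP; field.
by rewrite an !gt_eqF ?expR_gt0.
Qed.

(** Both remaining terms are of order [e^{a(t-s)} (1 + (t - s)) / (1 + t)],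
    hence of order [1 / (1 + t)], which any rate with [0 <= g <= 1] dominates;
    the exponent [3/4] is one choice in the admissible range. *)
Lemma critical_kernel_near t : 0 <= t ->
  kernel_near a t critical_kernel (3 / 4) ((1 + (- a)^-1) ^+ 2)
    (critical_resolvent t).
Proof.
move=> t0 s /andP[s0 st].
have s1 : 0 < 1 + s by lra.
have t1 : 0 < 1 + t by lra.
have /andP[c0 c1] := critical_tail_bounds t1.
have w0 : 0 <= (1 + s) * expR (- a * (1 + s)).
  by rewrite mulr_ge0 ?expR_ge0// ltW.
set E := expR (a * (t - s)).
have E0 : 0 <= E by exact: expR_ge0.
have EE : expR (- a * (1 + s)) * expR (a * (1 + t)) = E.
  by rewrite /E -expRD; congr expR; ring.
have -> : critical_resolvent t s - E - critical_kernel s =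
    - ((1 + s) * expR (- a * (1 + s)) * critical_tail (1 + t) +
       E * ((t - s) / (1 + t))).
  rewrite /critical_resolvent /critical_kernel -EE; field.
  by rewrite gt_eqF.
have ts0 : 0 <= t - s by lra.
have it0 : 0 <= (t - s) / (1 + t) by rewrite divr_ge0// ltW.
rewrite normrN ger0_norm; last first.
  by apply: addr_ge0; [exact: mulr_ge0 w0 c0|exact: mulr_ge0 E0 it0].
have ia0 : 0 <= (- a)^-1 by rewrite invr_ge0 ltW.
have h1 : (1 + s) * expR (- a * (1 + s)) * critical_tail (1 + t) <=
    E * ((- a)^-1 / (1 + t)).
  apply: le_trans (ler_wpM2l w0 c1) _.
  have -> : (1 + s) * expR (- a * (1 + s)) *
      (expR (a * (1 + t)) / (- a * (1 + t) ^+ 2)) =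
      E * ((- a)^-1 / (1 + t)) * ((1 + s) / (1 + t)).
    by rewrite -EE; field; rewrite an gt_eqF.
  rewrite ler_piMr ?mulr_ge0// ?invr_ge0 ?(ltW t1)//.
  by rewrite ler_pdivrMr// mul1r lerD2l.
have h2 := linear_le_expR al0 ts0.
have Ei : expR (- a * (t - s)) = E^-1 by rewrite mulNr expRN.
rewrite Ei in h2.
have h3 : E * (1 + (t - s)) <= 1 + (- a)^-1.
  by move: (ler_wpM2l E0 h2); rewrite mulrCA divff ?mulr1// gt_eqF// expR_gt0.
have h4 : (1 + t)^-1 <= kernel_rate (3 / 4) t s.
  have -> : (1 + t)^-1 = (1 + t) `^ (3 / 4 - 1) * (1 + t) `^ (- (3 / 4)).
    rewrite -powRD; last by rewrite (gt_eqF t1) implybT.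
    by rewrite -powR_inv1 ?(ltW t1)//; congr (_ `^ _); field.
  rewrite /kernel_rate ler_wpM2l ?powR_ge0// !powRN lef_pV2 ?posrE ?powR_gt0//.
  by apply: ge0_ler_powR; rewrite ?nnegrE; lra.
apply: (@le_trans _ _ ((1 + (- a)^-1) ^+ 2 * (1 + t)^-1)); last first.
  by rewrite ler_wpM2l ?sqr_ge0.
apply: (@le_trans _ _ (E * ((- a)^-1 + (t - s)) * (1 + t)^-1)).
  have -> : E * ((- a)^-1 + (t - s)) * (1 + t)^-1 =
    E * ((- a)^-1 / (1 + t)) + E * ((t - s) / (1 + t)) by ring.
  by rewrite lerD2r.
rewrite ler_wpM2r ?invr_ge0 ?(ltW t1)// expr2.
have h5 : E * ((- a)^-1 + (t - s)) <= (1 + (- a)^-1) * (E * (1 + (t - s))).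
  rewrite mulrCA ler_wpM2l//.
  by have := mulr_ge0 ia0 ts0; nra.
apply: le_trans h5 _; rewrite ler_wpM2l// addr_ge0//.
Qed.

Lemma critical_kernel_tricomi s : 0 <= s ->
  critical_kernel s = - a * (1 + s) * tricomiU 2 2 (- a * (1 + s)).
Proof.
move=> s0; rewrite tricomiU_22; last by rewrite mulr_gt0//; lra.
by rewrite /critical_kernel /critical_tail; ring.
Qed.

Lemma critical_kernel_continuous v :
  {within `[0, v], continuous critical_kernel}.
Proof.
apply: (is_derive_within_continuous (df := fun s =>
  (1 + s) * expR (- a * (1 + s)) * - (expR (a * (1 + s)) / (1 + s) ^+ 2) +
  critical_tail (1 + s) * ((1 + s) * (expR (- a * (1 + s)) * - a) +
    expR (- a * (1 + s))))) => s /andP[s0 _].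
have dc := is_derive_critical_tail s0.
eapply is_derive_eq; first by rewrite /critical_kernel; derive_rules.
by rewrite /=; ring.
Qed.

Definition critical_primitive t : R :=
  \int[lebesgue_measure]_(s in `[0, t]) (critical_kernel s * critical_kernel s).

Lemma critical_sqr_continuous v :
  {within `[0, v], continuous (fun s => critical_kernel s * critical_kernel s)}.
Proof.
have c : {within `[0, v], continuous critical_kernel}.
  exact: critical_kernel_continuous.
by move=> s; apply: cvgM; exact: c.
Qed.

Lemma is_derive_critical_primitive s : 0 < s ->
  is_derive s 1 critical_primitive (critical_kernel s * critical_kernel s).
Proof.
move=> s0.
have c : {within `[0, s + 1],
    continuous (fun s => critical_kernel s * critical_kernel s)}.
  exact: critical_sqr_continuous.
have h : 0 < s < s + 1 by lra.
exact: (primitive_is_derive c h).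
Qed.

Lemma critical_primitive_continuous v : 0 <= v ->
  {within `[0, v], continuous critical_primitive}.
Proof.
move=> v0; apply: primitive_continuous => //; exact: critical_sqr_continuous.
Qed.

Lemma critical_primitive0 : critical_primitive 0 = 0.
Proof. by rewrite /critical_primitive set_itv1 Rintegral_set1. Qed.

(** The primitive is nondecreasing and bounded, since the kernel is of order
    [1 / (1 + s)]. *)
Lemma critical_primitive_cvg : exists l : R, critical_primitive t @[t --> +oo] --> l.
Proof.
have nd x y : 0 <= x -> x <= y -> critical_primitive x <= critical_primitive y.
  move=> x0 xy; have y0 : 0 <= y by lra.
  have cy : {within `[x, y], continuous critical_primitive}.
    have c : {within `[0, y], continuous critical_primitive}.
      exact: critical_primitive_continuous.
    by apply: continuous_subspaceW c; apply: subset_itvr; rewrite bnd_simp.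
  rewrite -subr_ge0.
  have := @increment_le R (fun=> 0) critical_primitive (fun=> 0)
    (fun s => critical_kernel s * critical_kernel s) x y xy.
  rewrite subrr; apply=> //.
  - by move=> s; exact: cvg_cst.
  - by move=> s /andP[xs _]; apply: is_derive_critical_primitive; lra.
  - by move=> s _; rewrite -expr2 sqr_ge0.
have neg x : x < 0 -> critical_primitive x = 0.
  move=> x0; rewrite /critical_primitive set_itv_ge ?Rintegral_set0//.
  by rewrite bnd_simp -ltNge.
have ndT : {homo critical_primitive : x y / x <= y}.
  move=> x y xy; have [x0|x0] := leP 0 x; first exact: nd.
  by rewrite neg// Rintegral_ge0// => s _; rewrite -expr2 sqr_ge0.
exists (sup (range critical_primitive)); apply: nondecreasing_cvgr => //.
exists ((- a)^-1 ^+ 2) => _ [y _ <-].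
apply: (@le_trans _ _ (critical_primitive (Num.max y 0))).
  by apply: ndT; rewrite le_max lexx.
set v := Num.max y 0; have v0 : 0 <= v by rewrite le_max lexx orbT.
have cv : {within `[0, v], continuous critical_primitive}.
  exact: critical_primitive_continuous.
pose H s := - ((- a)^-1 ^+ 2 * (1 + s)^-1).
have dH s : 0 <= s -> is_derive s 1 H ((- a)^-1 ^+ 2 * (1 + s) ^- 2).
  move=> s0; have s1 : 1 + s != 0 by rewrite gt_eqF//; lra.
  by eapply is_derive_eq; [rewrite /H; derive_rules|rewrite /=; field; rewrite an s1].
have := @increment_le R critical_primitive H
  (fun s => critical_kernel s * critical_kernel s)
  (fun s => (- a)^-1 ^+ 2 * (1 + s) ^- 2) 0 v v0 cv.
rewrite critical_primitive0 subr0 => h; apply: (le_trans (h _ _ _ _)).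
- apply: (is_derive_within_continuous (df := fun s => (- a)^-1 ^+ 2 * (1 + s) ^- 2)).
  by move=> s /andP[s0 _]; exact: dH.
- by move=> s /andP[s0 _]; exact: is_derive_critical_primitive.
- by move=> s /andP[s0 _]; apply: dH; exact: ltW.
- move=> s /andP[s0 _]; have /andP[k0 k1] := critical_kernel_bounds (ltW s0).
  rewrite -exprVn -exprMn -expr2 lerXn2r ?nnegrE//.
  exact: le_trans k1.
rewrite /H addr0 invr1 mulr1 opprK.
have : 0 <= (- a)^-1 ^+ 2 * (1 + v)^-1.
  by rewrite mulr_ge0 ?sqr_ge0// invr_ge0; lra.
lra.
Qed.

Lemma integral_tricomi_sqr (l : R) : critical_primitive t @[t --> +oo] --> l ->
  (\int[lebesgue_measure]_(s in `[0%R, +oo[)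
     ((1 + s) ^+ 2 * tricomiU 2 2 (- a * (1 + s)) ^+ 2)%:E)%E = (l / a ^+ 2)%:E.
Proof.
move=> hl; pose k s := critical_kernel s * critical_kernel s / a ^+ 2.
transitivity (\int[lebesgue_measure]_(s in `[0%R, +oo[) (k s)%:E)%E.
  apply: eq_integral => s; rewrite inE/= in_itv/= andbT => s0.
  by rewrite /k critical_kernel_tricomi//; congr (_%:E); field.
have dF s : 0 < s -> is_derive s 1 (fun t => critical_primitive t / a ^+ 2) (k s).
  move=> s0; have h := is_derive_critical_primitive s0.
  by eapply is_derive_eq; [derive_rules|rewrite /k /=; ring].
rewrite (@ge0_continuous_FTC2y _ k (fun t => critical_primitive t / a ^+ 2) 0
  (l / a ^+ 2)).
- by rewrite critical_primitive0 mul0r sube0.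
- by move=> s _; rewrite /k divr_ge0 ?sqr_ge0// -expr2 sqr_ge0.
- have ck v : {within `[0, v], continuous k}.
    have c : {within `[0, v],
        continuous (fun s => critical_kernel s * critical_kernel s)}.
      exact: critical_sqr_continuous.
    by move=> s; apply: cvgMl; exact: c.
  apply/continuous_within_itvcyP; split.
    move=> s; rewrite in_itv/= andbT => s0.
    have c : {within `[0, s + 1], continuous k} by exact: ck.
    by apply: (within_segment_interior c); lra.
  have c : {within `[0, 1], continuous k} by exact: ck.
  by have /continuous_within_itvP := c; move=> /(_ ltr01)[].
- by apply: cvgMl.
- by move=> s s0; have /@ex_derive := dF s s0.
- have c : {within `[0, 1], continuous critical_primitive}.
    exact: critical_primitive_continuous.
  have /continuous_within_itvP := c; move=> /(_ ltr01)[_ c1 _].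
  by apply: cvgMl.
- move=> s; rewrite in_itv/= andbT => s0.
  by rewrite derive1E; have [_ ->] := dF s s0.
Qed.

End critical_kernel.

(** * Limits of the covariance *)

(** Once the resolvents are close to [e^{a(t-s)} + kap s], the limit splits into
    the stationary Ornstein-Uhlenbeck covariance and the total mass [l] of
    [kap ^ 2]; the cross terms are negligible. *)
Lemma covariance_limit (d : measure_display) (T : measurableType d)
    (R : realType) (P : probability T R) (F : R -> set (set T)) (B : R -> T -> R)
    (a b sigma : R) (psi : R -> R) (X : R -> T -> R) (Delta g K L l : R)
    (kap Psi : R -> R) :
  usual_filtration P F -> brownian_motion P B ->
  average_sde_solution P F B a b sigma psi X ->
  a < 0 -> 0 <= Delta -> 1 / 2 < g -> g < 1 -> 0 <= K -> 0 <= L ->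
  (forall s, 0 <= s -> 0 <= kap s <= L / (1 + s)) ->
  (forall t, 0 <= t -> exists p q,
     adjoint_pair a b t p q /\ kernel_near a t kap g K q) ->
  (forall t, 0 <= t -> {within `[0, t], continuous Psi}) ->
  (forall s : R, 0 < s -> is_derive s 1 Psi (kap s * kap s)) ->
  Psi 0 = 0 -> Psi t @[t --> +oo] --> l ->
  covariance P (X t) (X (t + Delta)) @[t --> +oo] -->
    (sigma ^+ 2 * (expR (a * Delta) / (2 * - a) + l))%:E.
Proof.
move=> Fu BM SX a0 D0 g1 g2 K0 L0 kapL near_t cPsi dPsi Psi0 Psil.
have [C HC] := kernel_increment_bound a0 D0 g1 g2 K0 L0 kapL.
pose v t := covariance P (X t) (X (t + Delta)).
have main t : 0 < t -> exists phi : R, v t = (sigma ^+ 2 * phi)%:E /\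
    `|phi - Psi t - expR (a * Delta) / (2 * - a) * (1 - expR (2 * a * t))| <=
      C * (1 + t) `^ (g - 1).
  move=> t0; have t0' := ltW t0.
  have [p [q [pq nq]]] := near_t _ t0'.
  have [p' [q' [pq' nq']]] := near_t _ (addr_ge0 t0' D0).
  have cq : {within `[0, t], continuous q} by exact: adjoint_continuous pq.
  have cq' : {within `[0, t], continuous q'}.
    have c : {within `[0, t + Delta], continuous q'}.
      exact: adjoint_continuous pq'.
    by apply: continuous_subspaceW c; apply: subset_itvl; rewrite bnd_simp lerDl.
  have cqq : {within `[0, t], continuous (fun s => q s * q' s)}.
    by move=> s; apply: cvgM; [exact: cq|exact: cq'].
  pose Phi z := (\int[lebesgue_measure]_(r in `[0, z]) (q r * q' r))%R.
  have cPhi : {within `[0, t], continuous Phi} by exact: primitive_continuous.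
  have dPhi s : 0 < s < t -> is_derive s 1 Phi (q s * q' s).
    by move=> st; exact: (primitive_is_derive cqq st).
  exists (Phi t - Phi 0); split.
    exact: (solution_covariance Fu BM SX t0 D0 pq pq' cPhi dPhi).
  have := HC t q q' Phi Psi t0' nq nq' cPhi (cPsi t t0') dPhi.
  rewrite Psi0 subr0; apply=> s /andP[s0 _]; exact: dPsi.
have [w [w1 w2]] : exists w : R -> R, (forall t, 0 < t -> v t = (sigma ^+ 2 * w t)%:E) /\
    forall t, 0 < t ->
      `|w t - Psi t - expR (a * Delta) / (2 * - a) * (1 - expR (2 * a * t))| <=
      C * (1 + t) `^ (g - 1).
  have [w hw] := choice (fun t : {t : R | 0 < t} => main (sval t) (svalP t)).
  exists (fun t => if pselect (0 < t) is left h then w (exist _ t h) else 0).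
  by split=> t t0; case: pselect => // h; have [] := hw (exist _ t h).
have lim := kernel_limit a0 g2 w2.
have limw : w t @[t --> +oo] --> expR (a * Delta) / (2 * - a) + l.
  have -> : w = (fun t => w t - Psi t + Psi t) by apply/funext => t; rewrite subrK.
  exact: cvgD lim Psil.
have limE : (sigma ^+ 2 * w t)%:E @[t --> +oo] -->
    (sigma ^+ 2 * (expR (a * Delta) / (2 * - a) + l))%:E.
  by apply: cvg_EFin; [exact: nearW|apply: cvgMr].
apply: cvg_trans limE; apply: near_eq_cvg; near=> t.
by rewrite -w1.
Unshelve. all: by end_near. Qed.

Theorem theorem3p4 (R : realType) (d : measure_display) (T : measurableType d)
    (P : probability T R) (F : R -> set (set T)) (B : R -> T -> R)
    (a b sigma : R) (psi : R -> R) (X : R -> T -> R)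
    (P_complete : measure_is_complete P)
    (F_usual : usual_filtration P F)
    (B_brownian : brownian_motion P B)
    (B_adapted : adapted F B)
    (sigma_gt0 : 0 < sigma)
    (a_lt0 : a < 0)
    (ab_le0 : a + b <= 0)
    (psi_continuous : {within `[-1, 0], continuous psi})
    (X_solution : average_sde_solution P F B a b sigma psi X) :
  forall Delta : R, 0 <= Delta ->
    (a + b < 0 ->
       covariance P (X t) (X (t + Delta)) @[t --> +oo] -->
         (sigma ^+ 2 / (2 * `|a|) * expR (a * Delta))%:E)
    /\
    (a + b = 0 ->
       covariance P (X t) (X (t + Delta)) @[t --> +oo] -->
         ((sigma ^+ 2 / (2 * `|a|) * expR (a * Delta))%:E
          + (sigma ^+ 2 * (b ^+ 2 / `|a| `^ (2 + 2 * b / a)))%:E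
            * \int[lebesgue_measure]_(s in `[0%R, +oo[)
                ((1 + s) ^+ 2
                 * tricomiU (1 - b / a) 2 (`|a| * (1 + s)) ^+ 2)%:E)%E).
Proof.
move=> Delta D0; rewrite ltr0_norm//.
have an : a != 0 by rewrite lt_eqF.
split=> [ab0|ab0].
- have [g [K [g1 g2 K0 hK]]] := adjoint_decay a_lt0 ab0.
  have -> : sigma ^+ 2 / (2 * - a) * expR (a * Delta) =
      sigma ^+ 2 * (expR (a * Delta) / (2 * - a) + 0) by field.
  apply: (@covariance_limit _ T R P F B a b sigma psi X Delta g K 0 0
    (fun=> 0) (fun=> 0)) => //.
  + by move=> s _; rewrite mul0r lexx.
  + move=> t t0; have [p [q pq]] := adjoint_pair_exists a b t0.
    exists p, q; split=> // s st; rewrite subr0; exact: hK pq s st.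
  + by move=> t _ s; exact: cvg_cst.
  + by move=> s _; rewrite mulr0; exact: is_derive_cst.
  + exact: cvg_cst.
have bE : b = - a by lra.
have [l hl] := critical_primitive_cvg a_lt0.
have e1 : 1 - b / a = 2 by rewrite bE; field.
have e2 : 2 + 2 * b / a = 0 by rewrite bE; field.
rewrite e1 e2 powRr0 (integral_tricomi_sqr a_lt0 hl) divr1 bE.
rewrite -EFinM -EFinD.
have -> : sigma ^+ 2 / (2 * - a) * expR (a * Delta) +
    sigma ^+ 2 * (- a) ^+ 2 * (l / a ^+ 2) =
    sigma ^+ 2 * (expR (a * Delta) / (2 * - a) + l) by field.
rewrite bE in X_solution.
apply: (@covariance_limit _ T R P F B a (- a) sigma psi X Delta (3 / 4)
  ((1 + (- a)^-1) ^+ 2) (- a)^-1 l (critical_kernel a) (critical_primitive a)) => //.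
- lra.
- lra.
- exact: sqr_ge0.
- by rewrite invr_ge0; lra.
- exact: critical_kernel_bounds.
- move=> t t0.
  exists (fun s => - ((critical_resolvent a t s - 1) / (1 + s))),
    (critical_resolvent a t); split; first exact: critical_adjoint_pair.
  exact: critical_kernel_near.
- exact: critical_primitive_continuous.
- exact: is_derive_critical_primitive.
- exact: critical_primitive0.
Qed.
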